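(* Let $n$ be even and let $A$ be an $n\times n$ matrix drawn from $\mathrm{GOE}(n)$. Let $A=\sum_{i=1}^n\lambda_iv_iv_i^T$ be its spectral decomposition with $\lambda_1\ge\dots\ge\lambda_n$, and let $$Z=\sum_{i=1}^n\left[(-1)^{\mathbb{1}[i>n/2]}\tfrac{3\pi}{8}\sqrt n-\lambda_i\right]v_iv_i^T.$$ Then for every $k\in[n]$ and every constant $K>0$, $\Pr\left[|Z_{kk}|\ge n^{1/6}\right]=O(n^{-K})$.
   Context: $\mathrm{GOE}(n)$: symmetric random matrix with independent entries (up to symmetry), $A_{ij}\sim\mathrm{N}(0,1)$ for $i<j$ and $A_{ii}\sim\mathrm{N}(0,2)$. The sign $(-1)^{\mathbb{1}[i>n/2]}$ is $+1$ for $i\le n/2$ and $-1$ for $i>n/2$. *)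

(* Defs.v *)
From HB Require Import structures.
From mathcomp Require Import all_boot all_order all_algebra.
From mathcomp Require Import all_classical all_reals all_analysis.
Set Implicit Arguments. Unset Strict Implicit. Unset Printing Implicit Defensive.
Import Order.TTheory GRing.Theory Num.Theory.
Local Open Scope classical_set_scope.
Local Open Scope ring_scope.

Definition goe_sd {R : realType} {n : nat} (i j : 'I_n) : R :=
  if i == j then Num.sqrt 2 else 1.

Definition GOE_mx {R : realType} {n : nat} {T : Type}
  (G : 'I_n -> 'I_n -> T -> R) (w : T) : 'M[R]_n :=
  \matrix_(i, j) G i j w.

Definition is_GOE {R : realType} {n : nat} {d : measure_display}
  {T : measurableType d} (P : probability T R)
  (G : 'I_n -> 'I_n -> T -> R) : Prop :=
  [/\ (forall i j, measurable_fun setT (G i j)),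
      (forall i j w, G i j w = G j i w),
      (forall (i j : 'I_n) (B : set R), (i <= j)%N -> measurable B ->
          P (G i j @^-1` B) = normal_prob 0 (goe_sd i j) B) &
      (forall (S : {set 'I_n * 'I_n}) (B : 'I_n * 'I_n -> set R),
          (forall p, p \in S -> (p.1 <= p.2)%N) ->
          (forall p, measurable (B p)) ->
          P (\big[setI/setT]_(p in S) (G p.1 p.2 @^-1` B p)) =
          (\prod_(p in S) P (G p.1 p.2 @^-1` B p))%E)].

Definition colproj {R : realType} {n : nat} (V : 'M[R]_n) (i : 'I_n) : 'M[R]_n :=
  col i V *m (col i V)^T.

Definition spectral_decomp {R : realType} {n : nat} (A : 'M[R]_n)
  (lam : 'I_n -> R) (V : 'M[R]_n) : Prop :=
  [/\ V^T *m V = 1%:M,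
      (forall i j : 'I_n, (i <= j)%N -> lam j <= lam i) &
      A = \sum_i lam i *: colproj V i].

(* The sign (-1)^{1[i > n/2]} with 1-based index i; for the 0-based
   index i0 = i - 1 this is +1 iff i0 < n/2. *)
Definition half_sign {R : realType} {n : nat} (i : 'I_n) : R :=
  if (i < n./2)%N then 1 else -1.

Definition Zmat {R : realType} {n : nat} (lam : 'I_n -> R) (V : 'M[R]_n)
  : 'M[R]_n :=
  \sum_i ((half_sign i * (3 * pi / 8) * Num.sqrt (n%:R)) - lam i) *: colproj V i.

(* Main.v *)
Require Import Defs.
From HB Require Import structures.
From mathcomp Require Import all_boot all_order all_algebra perm.
From mathcomp Require Import all_classical all_reals all_analysis.
From mathcomp Require Import measurable_realfun.
From mathcomp Require Import ring lra.
Set Implicit Arguments.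
Unset Strict Implicit.
Unset Printing Implicit Defensive.
Import Order.TTheory GRing.Theory Num.Theory.
Import numFieldNormedType.Exports.
Local Open Scope classical_set_scope.
Local Open Scope ring_scope.

(* By rotation invariance of GOE the events attached to e_k and to any unit
   vector u have the same probability: writing M for the sum of the signed
   projectors v_i v_i^T, P(|M_kk| >= s) = P(|u^T M u| >= s). Averaging over the
   vectors u = eps / sqrt n with signs eps turns u^T M u into a Rademacher chaos
   of order 2 for each fixed matrix (M has trace 0 because n is even, and
   M^2 = 1), whose moments are bounded by hypercontractivity. Since
   Z_kk = c sqrt n M_kk - A_kk, a Gaussian tail bound for A_kk concludes.

   M is a function of A only when A has simple spectrum. Matrices with a double
   eigenvalue lie on the cone {h = 0}, h(A) = det (1, A 1, ..., A^(n-1) 1). If G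
   and G' are independent copies and q = P(h(G) = 0), then also
   q = P(h(G - l G') = 0) for l = 1, 2, ...; a polynomial in l with infinitely
   many roots vanishes, so q <= P(h(G) = 0 and h(G') = 0) = q^2. As G is close
   to diag(0, ..., n-1) with positive probability, q = 0. *)

(** * The Gaussian measure on the plane *)

(** No information on the location of the eigenvalues is needed. Since M^2 = 1, the rows of M are
    unit vectors, so u^T M u is typically of order n^(-1/2) for a random sign vector and c sqrt n
    M_kk is of order 1. Against the threshold n^(1/6), a moment of order 2(p+1) then gains
    n^(-(p+1)/3), which beats n^(-K) once p+1 >= 3K. Two obstacles come from the quantifier over all
    spectral decompositions in the event. Its measurability is not automatic; it rests on the
    compactness of the orthogonal group. And for a fixed A the events of different sign vectors
    could be witnessed by different decompositions, whereas averaging over signs needs one and the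
    same M in all of them; this is where simplicity of the spectrum enters. Invariance is
    established for plane rotations only, entry by entry on independent normal families. This
    suffices because finitely many plane rotations carry any unit vector to e_k or -e_k. *)

Definition image_measure {d1 d2 : measure_display} {T1 : measurableType d1}
    {T2 : measurableType d2} {R : realType} (m : {measure set T1 -> \bar R})
    (f : T1 -> T2) (mf : measurable_fun setT f) : {measure set T2 -> \bar R} :=
  measure_function_pushforward__canonical__measure_function_Measure m mf.

(** Lebesgue measure is determined by the lengths of half-open intervals, and [s] times its
    pushforward under x -> s x + a assigns the same lengths. *)
Lemma ge0_integral_lebesgue_affine {R : realType} (s a : R) (f : R -> \bar R) :
  0 < s -> measurable_fun setT f -> (forall x, (0 <= f x)%E) ->
  (\int[lebesgue_measure]_x f x =
   s%:E * \int[lebesgue_measure]_x f (s * x + a)%R)%E.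
Proof.
move=> s0 mf f0.
pose h (x : measurableTypeR R) : measurableTypeR R := s * x + a.
have mh : measurable_fun setT h.
  by apply: measurable_funD => //; apply: measurable_funM.
pose sn : {nonneg R} := NngNum (ltW s0).
pose nu : {measure set (measurableTypeR R) -> \bar R} :=
  mscale sn (image_measure lebesgue_measure mh).
have E A : measurable A -> lebesgue_measure A = nu A.
  apply: lebesgue_measure_unique => X [[u v] _ <-] /=.
  rewrite /nu /mscale /= /pushforward.
  have -> : h @^-1` `]u, v] = `]((u - a) / s), ((v - a) / s)]%classic.
    apply/seteqP; split => x /=; rewrite !in_itv /= /h.
      by rewrite ltr_pdivrMr // ler_pdivlMr // mulrC ltrBlDr lerBrDr.
    by rewrite ltr_pdivrMr // ler_pdivlMr // (mulrC x) ltrBlDr lerBrDr.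
  rewrite !lebesgue_measure_itv /= !lte_fin ltr_pM2r ?invr_gt0 //.
  rewrite ltrBlDr subrK; case: ifP => _; last by rewrite mule0.
  rewrite -!EFinB -EFinM -mulrBl mulrCA mulfV ?gt_eqF // mulr1.
  by congr EFin; ring.
rewrite (eq_measure_integral nu); last by move=> A mA _; exact: E.
rewrite /nu ge0_integral_mscale //= ge0_integral_pushforward //.
Qed.

Section plane.
Context {R : realType}.
Local Notation mu := (@lebesgue_measure R).
Implicit Types F : R * R -> \bar R.

(** An iterated integral, so that a shear becomes a translation in one variable. *)
Definition iint F : \bar R := (\int[mu]_x \int[mu]_y F (x, y))%E.

Let swap F : measurable_fun setT F -> (forall z, (0 <= F z)%E) ->
  iint F = (\int[mu]_y \int[mu]_x F (x, y))%E.
Proof. by move=> mF F0; exact: fubini_tonelli. Qed.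

Lemma iint_shear2 (a : R) F :
  measurable_fun setT F -> (forall z, (0 <= F z)%E) ->
  iint (fun z => F (z.1, z.2 + a * z.1)) = iint F.
Proof.
move=> mF F0; apply: eq_integral => x _ /=.
rewrite [RHS](@ge0_integral_lebesgue_affine _ 1 (a * x)) //; last first.
  by apply: measurableT_comp => //; exact: measurable_fun_pair.
by rewrite mul1e; apply: eq_integral => y _; rewrite mul1r.
Qed.

Lemma iint_shear1 (a : R) F :
  measurable_fun setT F -> (forall z, (0 <= F z)%E) ->
  iint (fun z => F (z.1 + a * z.2, z.2)) = iint F.
Proof.
move=> mF F0.
have mF' : measurable_fun setT (fun z : R * R => F (z.1 + a * z.2, z.2)).
  apply: measurableT_comp => //; apply: measurable_fun_pair => //=.
  by apply: measurable_funD => //; apply: measurable_funM.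
rewrite (swap mF' (fun z => F0 _)) (swap mF F0); apply: eq_integral => y _ /=.
rewrite [RHS](@ge0_integral_lebesgue_affine _ 1 (a * y)) //; last first.
  by apply: measurableT_comp => //; exact: measurable_fun_pair.
by rewrite mul1e; apply: eq_integral => x _; rewrite mul1r.
Qed.

(* A rotation is a product of three shears. *)
Lemma iint_rotation (c s : R) F : s != 0 -> c ^+ 2 + s ^+ 2 = 1 ->
  measurable_fun setT F -> (forall z, (0 <= F z)%E) ->
  iint (fun z => F (c * z.1 - s * z.2, s * z.1 + c * z.2)) = iint F.
Proof.
(* For a rotation by the angle x, [a] is - tan (x/2), the factor of the first and third shears; the
   middle one has factor [s]. The division is the reason for [s != 0] here and in all later rotation
   lemmas. *)
move=> s0 cs mF F0; set a := (c - 1) / s.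
have as_ : a * s = c - 1 by rewrite /a divfK.
have ac : a * (1 + c) = - s.
  apply: (mulIf s0); rewrite mulrAC as_; move: cs => /eqP.
  by rewrite -subr_eq0 => /eqP cs; apply/eqP; rewrite -subr_eq0 -cs; apply/eqP; ring.
have mF1 : measurable_fun setT (fun z : R * R => F (z.1 + a * z.2, z.2)).
  apply: measurableT_comp => //; apply: measurable_fun_pair => //=.
  by apply: measurable_funD => //; apply: measurable_funM.
have mF2 : measurable_fun setT
    (fun z : R * R => F (z.1 + a * (z.2 + s * z.1), z.2 + s * z.1)).
  have m2s : measurable_fun setT (fun z : R * R => z.2 + s * z.1).
    by apply: measurable_funD => //; apply: measurable_funM.
  apply: measurableT_comp => //; apply: measurable_fun_pair => //=.
  by apply: measurable_funD => //; apply: measurable_funM.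
rewrite -(iint_shear1 a mF F0).
rewrite -(iint_shear2 s mF1 (fun z => F0 _)).
rewrite -(iint_shear1 a mF2 (fun z => F0 _)).
congr iint; apply/funext => -[x y] /=; congr (F (_, _)).
  transitivity ((1 + a * s) * x + a * (1 + (1 + a * s)) * y); last by ring.
  by have -> : 1 + a * s = c by [rewrite as_; ring]; rewrite ac; ring.
transitivity (s * x + (1 + a * s) * y); last by ring.
by rewrite as_; ring.
Qed.

Definition gauss2 (z : R * R) : R := normal_pdf 0 1 z.1 * normal_pdf 0 1 z.2.

Let m2 := (lebesgue_measure \x @lebesgue_measure R)%E.

Lemma gauss2_ge0 z : 0 <= gauss2 z.
Proof. by rewrite mulr_ge0 ?normal_pdf_ge0. Qed.

Lemma measurable_gauss2 : measurable_fun setT gauss2.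
Proof.
apply: measurable_funM; (apply: measurableT_comp; first exact: measurable_normal_pdf) => //.
Qed.

Lemma gauss2_rotation (c s : R) (z : R * R) : c ^+ 2 + s ^+ 2 = 1 ->
  gauss2 (c * z.1 - s * z.2, s * z.1 + c * z.2) = gauss2 z.
Proof.
move=> cs; rewrite /gauss2 !normal_pdfE ?oner_neq0 // /normal_fun /=.
rewrite mulrACA [RHS]mulrACA -!expRD; congr (_ * expR _).
rewrite !subr0 -!mulrDl -!opprD; congr (- _ * _).
have -> : (c * z.1 - s * z.2) ^+ 2 + (s * z.1 + c * z.2) ^+ 2 =
  (c ^+ 2 + s ^+ 2) * (z.1 ^+ 2 + z.2 ^+ 2) by ring.
by rewrite cs mul1r.
Qed.

(** Given by a density rather than as a product of normal laws: rotation invariance is then that of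
    the density together with that of Lebesgue measure. *)
Definition gauss_plane (C : set (R * R)) : \bar R :=
  (\int[m2]_(z in C) (gauss2 z)%:E)%E.

Let mEgauss2 : measurable_fun setT (EFin \o gauss2).
Proof. by apply/measurable_EFinP; exact: measurable_gauss2. Qed.

Let gauss_plane0 : gauss_plane set0 = 0%E.
Proof. by rewrite /gauss_plane integral_set0. Qed.

Let gauss_plane_ge0 C : (0 <= gauss_plane C)%E.
Proof. by apply: integral_ge0 => z _; rewrite lee_fin gauss2_ge0. Qed.

Let gauss_plane_sigma_additive : semi_sigma_additive gauss_plane.
Proof.
move=> A mA tA mUA; rewrite /gauss_plane ge0_integral_bigcup //=.
- apply: is_cvg_ereal_nneg_natsum_cond => n _ _.
  by apply: integral_ge0 => z _; rewrite lee_fin gauss2_ge0.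
- exact: measurable_funTS.
- by move=> z _; rewrite lee_fin gauss2_ge0.
Qed.

HB.instance Definition _ := isMeasure.Build _ _ _
  gauss_plane gauss_plane0 gauss_plane_ge0 gauss_plane_sigma_additive.

Lemma gauss_planeE C : measurable C ->
  gauss_plane C = iint (fun z => (gauss2 z * \1_C z)%:E).
Proof.
move=> mC; rewrite /gauss_plane integral_mkcond.
transitivity (\int[m2]_z (gauss2 z * \1_C z)%:E)%E.
  by rewrite epatch_indic; apply: eq_integral => z _; rewrite EFinM.
apply: fubini_tonelli1.
- apply/measurable_EFinP/measurable_funM; [exact: measurable_gauss2|].
  exact: measurable_indic.
- by move=> z; rewrite lee_fin mulr_ge0 ?gauss2_ge0.
Qed.

Lemma gauss_plane_rect A B : measurable A -> measurable B ->
  gauss_plane (A `*` B) = (normal_prob 0 1 A * normal_prob (0 : R) 1 B)%E.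
Proof.
move=> mA mB; rewrite gauss_planeE; last exact: measurableX.
have nE C : measurable C -> normal_prob (0 : R) 1 C =
    (\int[mu]_x (normal_pdf 0 1 x * \1_C x)%:E)%E.
  move=> mC; rewrite /normal_prob integral_mkcond epatch_indic.
  by apply: eq_integral => z _; rewrite EFinM.
have mn C : measurable C ->
    measurable_fun setT (fun x : R => (normal_pdf 0 1 x * \1_C x)%:E).
  move=> mC; apply/measurable_EFinP/measurable_funM.
    exact: measurable_normal_pdf.
  exact: measurable_indic.
have n0 (C : set R) x : (0 <= (normal_pdf 0 1 x * \1_C x)%:E)%E.
  by rewrite lee_fin mulr_ge0 ?normal_pdf_ge0.
rewrite (nE A mA) -ge0_integralZr //; last first.
  exact: mn.
apply: eq_integral => x _; rewrite (nE B mB) -ge0_integralZl //; last exact: mn.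
apply: eq_integral => y _; rewrite -EFinM !indicE in_setX -mulnb natrM.
by congr EFin; rewrite /gauss2 /=; ring.
Qed.

Lemma gauss_plane_rot (c s : R) (C : set (R * R)) : s != 0 ->
  c ^+ 2 + s ^+ 2 = 1 -> measurable C ->
  gauss_plane ((fun z => (c * z.1 - s * z.2, s * z.1 + c * z.2)) @^-1` C) =
  gauss_plane C.
Proof.
move=> s0 cs mC.
have mr : measurable_fun setT
    (fun z : R * R => (c * z.1 - s * z.2, s * z.1 + c * z.2)).
  apply: measurable_fun_pair.
    by apply: measurable_funB; apply: measurable_funM.
  by apply: measurable_funD; apply: measurable_funM.
have mC' : measurable ((fun z : R * R =>
    (c * z.1 - s * z.2, s * z.1 + c * z.2)) @^-1` C).
  by rewrite -[X in measurable X]setTI; exact: mr.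
rewrite (gauss_planeE mC) (gauss_planeE mC').
rewrite -(iint_rotation s0 cs (F := fun z => (gauss2 z * \1_C z)%:E)).
- by congr iint; apply/funext => z /=; rewrite gauss2_rotation.
- apply/measurable_EFinP/measurable_funM; [exact: measurable_gauss2|].
  exact: measurable_indic.
- by move=> z; rewrite lee_fin mulr_ge0 ?gauss2_ge0.
Qed.
End plane.

(** * Tail and scaling of the normal law on the line *)

Section normal_facts.
Context {R : realType}.
Local Notation mu := (@lebesgue_measure R).

(** Half of the exponent is at most its value at [t]; the other half is, up to the ratio of the
    peaks, the density of the normal law with variance 2 s^2, whose total mass is 1. *)
Lemma normal_prob_tail (s : R) : s != 0 -> exists2 C : R, 0 <= C &
  forall t, 0 <= t ->
    (normal_prob 0 s [set x : R | (t <= `|x|)%R] <=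
     (C * expR (- (t ^+ 2 / (s ^+ 2 *+ 4))))%:E)%E.
Proof.
move=> s0; set s2 := Num.sqrt 2 * s.
have s20 : s2 != 0 by rewrite mulf_neq0 // sqrtr_eq0 -ltNge ltr0n.
have s2E : s2 ^+ 2 = s ^+ 2 *+ 2.
  by rewrite exprMn sqr_sqrtr ?ler0n // mulr_natl.
exists (normal_peak s / normal_peak s2).
  by rewrite divr_ge0 ?normal_peak_ge0.
move=> t t0; set c := (X in (_ <= X%:E)%E).
have c0 : 0 <= c by rewrite mulr_ge0 ?expR_ge0 // divr_ge0 ?normal_peak_ge0.
have mA : measurable [set x : R | (t <= `|x|)%R].
  rewrite -[X in measurable X]setTI.
  by apply: measurable_fun_le => //=; exact: measurableT_comp.
apply: (@le_trans _ _ (c%:E * normal_prob 0 s2 [set x : R | (t <= `|x|)%R])%E).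
  rewrite /normal_prob -ge0_integralZl //=; last 2 first.
  - apply: measurable_funTS; apply/measurable_EFinP; exact: measurable_normal_pdf.
  - by move=> x _; rewrite lee_fin normal_pdf_ge0.
  apply: ge0_le_integral => //=.
  - by move=> x _; rewrite lee_fin normal_pdf_ge0.
  - apply: measurable_funTS; apply/measurable_EFinP; exact: measurable_normal_pdf.
  - apply: measurable_funTS; apply/measurable_EFinP.
    by apply: measurable_funM => //; exact: measurable_normal_pdf.
  move=> x tx; rewrite -EFinM lee_fin !normal_pdfE // /normal_fun !subr0 /c.
  have p2 : normal_peak s2 != 0 by rewrite gt_eqF ?normal_peak_gt0.
  have cancel (p q a b : R) : q != 0 -> p / q * a * (q * b) = p * (a * b).
    by move=> ?; field.
  rewrite cancel // -expRD.
  rewrite ler_wpM2l ?normal_peak_ge0 // ler_expR s2E.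
  have ss : 0 < s ^+ 2 by rewrite exprn_even_gt0.
  have tx2 : t ^+ 2 <= x ^+ 2 by rewrite -(real_normK (num_real x)) lerXn2r ?nnegrE.
  set q := s ^+ 2 in ss *.
  have -> : - x ^+ 2 / (q *+ 2) = - (x ^+ 2 / (q *+ 4)) - x ^+ 2 / (q *+ 4).
    by field; rewrite gt_eqF.
  have -> : - x ^+ 2 / (q *+ 2 *+ 2) = - (x ^+ 2 / (q *+ 4)).
    by rewrite mulNr -mulrnA.
  by rewrite lerD2r lerN2 ler_wpM2r // invr_ge0 mulrn_wge0 // ltW.
rewrite -[leRHS]mule1 lee_wpmul2l ?lee_fin // probability_le1 //.
Qed.

Lemma normal_prob_scale (s : R) (B : set R) : 0 < s -> measurable B ->
  normal_prob 0 s ((fun x => x / s) @^-1` B) = normal_prob 0 1 B.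
Proof.
move=> s0 mB.
have mB' : measurable ((fun x : R => x / s) @^-1` B).
  by rewrite -[X in measurable X]setTI; exact: (mulrr_measurable s^-1).
pose f (x : R) := ((normal_pdf 0 s x)%:E *
  (\1_((fun x : R => (x / s)%R) @^-1` B) x)%:E)%E.
have mf : measurable_fun setT f.
  by apply: emeasurable_funM; apply/measurable_EFinP;
    [exact: measurable_normal_pdf|exact: measurable_indic].
have f0 x : (0 <= f x)%E by rewrite mule_ge0 // lee_fin // normal_pdf_ge0.
have maff : measurable_fun setT (fun x : R => s * x + 0).
  by apply: measurable_funD => //; apply: measurable_funM.
rewrite /normal_prob integral_mkcond epatch_indic.
rewrite [LHS](ge0_integral_lebesgue_affine 0 s0 mf f0).
rewrite [RHS]integral_mkcond epatch_indic -ge0_integralZl //; last 2 first.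
- exact: (measurableT_comp mf maff).
- by rewrite lee_fin ltW.
have sK x : s * x / s = x by rewrite mulrAC mulfV ?gt_eqF ?mul1r.
apply: eq_integral => x _; rewrite /f /= addr0 muleA.
have -> : \1_((fun x : R => x / s) @^-1` B) (s * x) = \1_B x :> R.
  rewrite !indicE; congr (_%:R); congr nat_of_bool.
  apply/idP/idP => /set_mem /=; rewrite ?sK => h; apply: mem_set => //=.
  by rewrite sK.
congr (_ * _)%E.
rewrite -EFinM !normal_pdfE ?gt_eqF ?ltr01 // /normal_fun /normal_peak !subr0.
rewrite mulrA; congr (_ * expR _)%:E.
  rewrite expr1n mul1r -mulrnAr sqrtrM ?sqr_ge0 // sqrtr_sqr gtr0_norm //.
  by rewrite invfM mulrA mulfV ?gt_eqF ?mul1r.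
rewrite expr1n exprMn -mulrnAr; field; rewrite gt_eqF //.
Qed.
End normal_facts.

(** * Families of independent standard normal variables *)

Lemma measure_prod_unique {d1 d2 : measure_display} {T1 : measurableType d1}
    {T2 : measurableType d2} {R : realType}
    (m1 m2 : {measure set (T1 * T2) -> \bar R}) :
  (m1 setT < +oo)%E ->
  (forall A B, measurable A -> measurable B -> m1 (A `*` B) = m2 (A `*` B)) ->
  forall C, measurable C -> m1 C = m2 C.
Proof.
move=> m1T E C mC.
apply: (measure_unique [set A `*` B | A in measurable & B in measurable]
  (fun=> setT)) => //.
- exact: measurable_prod_measurableType.
- move=> _ _ [A mA [B mB <-]] [A' mA' [B' mB' <-]].
  exists (A `&` A'); first exact: measurableI.
  by exists (B `&` B'); [exact: measurableI|rewrite setXI].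
- by move=> _; exists setT => //; exists setT => //; rewrite setXTT.
- by rewrite bigcup_const.
- by move=> _ [A mA [B mB <-]]; exact: E.
Qed.

Lemma measurable_forall_fin {d : measure_display} {T : measurableType d}
    {I : finType} (A : I -> set T) :
  (forall i, measurable (A i)) -> measurable [set w | forall i, A i w].
Proof.
move=> mA.
have -> : [set w | forall i, A i w] = \bigcap_(i in [set: I]) A i.
  by apply/seteqP; split => w /= h i //; exact: h.
exact: fin_bigcap_measurable.
Qed.

(** Independence and the marginal laws are stated together by one product formula over boxes;
    choosing [B i = setT] for some indices gives the formula for subfamilies. *)
Definition iid_normal {R : realType} {I : finType} {d : measure_display}
    {T : measurableType d} (P : probability T R) (X : I -> T -> R) : Prop :=
  (forall i, measurable_fun setT (X i)) /\
  (forall B : I -> set R, (forall i, measurable (B i)) ->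
     P [set w | forall i, B i (X i w)] =
     (\prod_i normal_prob 0 1 (B i))%E).

Lemma measurable_preimage {d1 d2 : measure_display} {T1 : measurableType d1}
    {T2 : measurableType d2} (f : T1 -> T2) (B : set T2) :
  measurable_fun setT f -> measurable B -> measurable (f @^-1` B).
Proof. by move=> mf mB; rewrite -[X in measurable X]setTI; exact: mf. Qed.

Section iid.
Context {R : realType} {d : measure_display} {T : measurableType d}.
Variable P : probability T R.

(** The other coordinates are frozen in the event [E0]. The law of the pair (X a, X b) restricted to
    [E0] agrees on rectangles, hence everywhere, with a multiple of the planar Gaussian measure, and
    that measure is invariant under rotation. *)
Lemma iid_normal_rot2 (I : finType) (X : I -> T -> R) (a b : I) (c s : R) :
  a != b -> s != 0 -> c ^+ 2 + s ^+ 2 = 1 -> iid_normal P X ->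
  iid_normal P (fun i w => if i == a then c * X a w - s * X b w
                           else if i == b then s * X a w + c * X b w
                           else X i w).
Proof.
move=> ab s0 cs [mX PX]; split.
  move=> i; have [_|_] := eqVneq i a; last have [_|_ //] := eqVneq i b.
    by apply: measurable_funB; apply: measurable_funM.
  by apply: measurable_funD; apply: measurable_funM.
move=> B mB.
pose E0 := [set w | forall i, (if (i == a) || (i == b) then setT else B i) (X i w)].
have mE0 : measurable E0.
  apply: measurable_forall_fin => i; apply: measurable_preimage => //.
  by case: ifP.
have mXX : measurable_fun setT (fun w => (X a w, X b w)).
  exact: measurable_fun_pair.
pose m1 := image_measure (mrestr P mE0) mXX.
pose p : \bar R := (\prod_(i | (i != a) && (i != b)) normal_prob (0 : R) 1 (B i))%E.
have p0 : (0 <= p)%E by apply: prode_ge0 => i _; exact: measure_ge0.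
have pfin : p \is a fin_num.
  by apply: prode_fin_num => i _; apply: fin_num_measure; exact: mB.
pose pn : {nonneg R} := NngNum (fine_ge0 p0).
pose m2 : {measure set (R * R) -> \bar R} := mscale pn (@gauss_plane R).
have prodE (B' : I -> set R) : (forall i, i != a -> i != b -> B' i = B i) ->
    (\prod_i normal_prob (0 : R) 1 (B' i) =
     p * (normal_prob (0 : R) 1 (B' a) * normal_prob (0 : R) 1 (B' b)))%E.
  move=> BB; rewrite (bigD1 a) //= (bigD1 b) //=; last by rewrite eq_sym.
  rewrite muleA muleC; congr (_ * _)%E.
  by apply: eq_bigr => i /andP[ia ib]; rewrite BB.
have m1E C : m1 C = P ((fun w => (X a w, X b w)) @^-1` C `&` E0) by [].
have m2E C : m2 C = ((fine p)%:E * gauss_plane C)%E by [].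
have m1fin : (m1 setT < +oo)%E.
  rewrite m1E; apply: (@le_lt_trans _ _ 1%E); last by rewrite ltry.
  apply: probability_le1; apply: measurableI => //.
  exact: measurable_preimage.
have rect A1 A2 : measurable A1 -> measurable A2 ->
    m1 (A1 `*` A2) = m2 (A1 `*` A2).
  move=> mA1 mA2.
  pose B' i := if i == a then A1 else if i == b then A2 else B i.
  rewrite m1E m2E gauss_plane_rect // fineK //.
  have -> : (fun w => (X a w, X b w)) @^-1` (A1 `*` A2) `&` E0 =
            [set w | forall i, B' i (X i w)].
    apply/seteqP; split => w /=.
      move=> [[/= A1w A2w] E0w] i; rewrite /B'; have := E0w i.
      by have [->|ia] := eqVneq i a => //; have [->|ib] := eqVneq i b.
    move=> h; split; first split => /=.
    - by have := h a; rewrite /B' eqxx.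
    - by have := h b; rewrite /B' eq_sym (negbTE ab) eqxx.
    move=> i; have := h i; rewrite /B'.
    by have [->|ia] := eqVneq i a => //; have [->|ib] := eqVneq i b.
  rewrite PX; last by move=> i; rewrite /B'; case: ifP => // _; case: ifP.
  rewrite (prodE B') ?/B' ?eqxx 1?[b == a]eq_sym ?(negbTE ab) //.
  by move=> i /negbTE -> /negbTE ->.
have m12 := measure_prod_unique m1fin rect.
rewrite (prodE B) // -gauss_plane_rect //.
rewrite -(gauss_plane_rot s0 cs); last exact: measurableX.
have := m12 ((fun z => (c * z.1 - s * z.2, s * z.1 + c * z.2)) @^-1` (B a `*` B b)).
rewrite m2E fineK // => <-; last first.
  apply: measurable_preimage; last exact: measurableX.
  apply: measurable_fun_pair.
    by apply: measurable_funB; apply: measurable_funM.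
  by apply: measurable_funD; apply: measurable_funM.
rewrite m1E; congr (P _); apply/seteqP; split => w /=.
  move=> h; split; first split => /=.
  - by have := h a; rewrite eqxx.
  - by have := h b; rewrite eq_sym (negbTE ab) eqxx.
  move=> i; have := h i.
  by have [->|ia] := eqVneq i a => //; have [->|ib] := eqVneq i b.
move=> [[/= h1 h2] E0w] i; have := E0w i.
by have [->|ia] := eqVneq i a => //; have [->|ib] := eqVneq i b.
Qed.

(** Rotates all the disjoint pairs {i, sg i} at once, [A] marking the first member of each pair; the
    pairs are treated one after the other. Three pairings are used: two rows of a matrix, transposed
    positions, and two independent copies. *)
Lemma iid_normal_rotate (I : finType) (X : I -> T -> R) (sg : I -> I)
    (A : pred I) (c s : R) :
  involutive sg -> (forall i, A i -> ~~ A (sg i)) ->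
  s != 0 -> c ^+ 2 + s ^+ 2 = 1 -> iid_normal P X ->
  iid_normal P (fun i w => if A i then c * X i w - s * X (sg i) w
                           else if A (sg i) then s * X (sg i) w + c * X i w
                           else X i w).
Proof.
move=> sgK Asg s0 cs iX.
have rot_seq (r : seq I) : uniq r -> (forall i, i \in r -> sg i \notin r) ->
    iid_normal P (fun i w => if i \in r then c * X i w - s * X (sg i) w
                           else if sg i \in r then s * X (sg i) w + c * X i w
                           else X i w).
  elim: r => [|a r IH]; first by [].
  move=> /= /andP[ar ur] h.
  have {}IH : iid_normal P (fun i w => if i \in r then c * X i w - s * X (sg i) w
                           else if sg i \in r then s * X (sg i) w + c * X i w
                           else X i w).
    apply: IH => // i ir; have := h i; rewrite !inE ir orbT => /(_ isT).
    by rewrite negb_or => /andP[].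
  have := h a; rewrite !inE eqxx negb_or => /(_ isT) /andP[sgaa sgar].
  have asga : a != sg a by rewrite eq_sym.
  have := iid_normal_rot2 asga s0 cs IH.
  rewrite (negbTE ar) (negbTE sgar) sgK (negbTE ar).
  congr iid_normal; apply/funext => i; apply/funext => w.
  rewrite !inE; have [->|ia] /= := eqVneq i a => //.
  have [->|isa] /= := eqVneq i (sg a).
    by rewrite (negbTE sgar) sgK eqxx.
  have [e|_] //= := eqVneq (sg i) a.
  by move: isa; rewrite -e sgK eqxx.
have memA i : (i \in enum A) = A i by rewrite mem_enum.
have nA i : i \in enum A -> sg i \notin enum A by rewrite !memA; exact: Asg.
have := rot_seq (enum A) (enum_uniq A) nA.
by congr iid_normal; apply/funext => i; apply/funext => w; rewrite !memA.
Qed.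

Lemma iid_normal_reindex (I J : finType) (X : I -> T -> R) (f : J -> I) :
  injective f -> iid_normal P X -> iid_normal P (fun j => X (f j)).
Proof.
move=> finj [mX PX]; split=> [j|B mB]; first exact: mX.
pose B' i := if [pick j | f j == i] is Some j then B j else setT.
have B'f j : B' (f j) = B j.
  rewrite /B'; case: pickP => [k /eqP/finj -> //|/(_ j)].
  by rewrite eqxx.
have -> : [set w | forall j, B j (X (f j) w)] = [set w | forall i, B' i (X i w)].
  apply/seteqP; split => w /= h.
    by move=> i; rewrite /B'; case: pickP => // j /eqP <-.
  by move=> j; have := h (f j); rewrite B'f.
rewrite PX; last by move=> i; rewrite /B'; case: pickP.
transitivity (\prod_(i in f @: [set: J]%SET) normal_prob (0 : R) 1 (B' i))%E.
  rewrite [RHS]big_mkcond; apply: eq_bigr => i _; case: ifPn => // iN.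
  rewrite /B'; case: pickP => [j /eqP ji|_]; last exact: probability_setT.
  by move: iN; rewrite -ji imset_f ?inE.
rewrite big_imset /=; last by move=> x y _ _; exact: finj.
by apply: eq_big => [j|j _]; rewrite ?inE ?B'f.
Qed.

Lemma iid_normal_copy (I : finType) (X : I -> T -> R) : iid_normal P X ->
  iid_normal (P \x P)%E (fun (bi : bool * I) w =>
    if bi.1 then X bi.2 w.1 else X bi.2 w.2).
Proof.
move=> [mX PX]; split=> [[[] i] /=|B mB].
- exact: measurableT_comp.
- exact: measurableT_comp.
have mE b : measurable [set w | forall i, B (b, i) (X i w)].
  by apply: measurable_forall_fin => i; exact: measurable_preimage.
have -> : [set w : T * T | forall bi, B bi (if bi.1 then X bi.2 w.1 else X bi.2 w.2)]
    = [set w | forall i, B (true, i) (X i w)] `*`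
      [set w | forall i, B (false, i) (X i w)].
  apply/seteqP; split => -[w1 w2] /=.
    by move=> h; split=> i; [exact: (h (true, i))|exact: (h (false, i))].
  by move=> [h1 h2] [[] i] /=.
transitivity (P [set w | forall i, B (true, i) (X i w)] *
              P [set w | forall i, B (false, i) (X i w)])%E.
  exact: product_measure1E.
rewrite (PX (fun i => B (true, i))) // (PX (fun i => B (false, i))) //.
transitivity (\prod_b \prod_i normal_prob (0 : R) 1 (B (b, i)))%E.
  by rewrite big_bool.
rewrite (pair_bigA _ (fun b i => normal_prob (0 : R) 1 (B (b, i)))) /=.
by apply: eq_bigr => -[].
Qed.

End iid.

(** Boxes form a pi-system generating the product sigma-algebra on [I -> R]. A finite family becomes
    a single random element whose law is determined by its values on boxes. *)
Definition boxes (R : realType) (I : finType) : set (set (I -> R)) :=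
  [set [set x | forall i, B i (x i)] | B in
    [set B : I -> set R | forall i, measurable (B i)]].
Arguments boxes : clear implicits.

Notation box_measurable R I := (g_sigma_algebraType (boxes R I)).

Lemma measurable_box_coord (R : realType) (I : finType) (i : I) :
  measurable_fun setT (fun x : box_measurable R I => x i).
Proof.
move=> _ B mB; rewrite setTI; apply: sub_sigma_algebra.
exists (fun j => if j == i then B else setT) => /=.
  by move=> j; case: ifP.
apply/seteqP; split => x /=; first by move=> /(_ i); rewrite eqxx.
by move=> Bx j; case: eqP => [->|].
Qed.

Lemma measurable_box_family (R : realType) (I : finType) (d : measure_display)
    (T : measurableType d) (X : I -> T -> R) :
  (forall i, measurable_fun setT (X i)) ->
  measurable_fun setT (fun w : T => (fun i => X i w) : box_measurable R I).
Proof.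
move=> mX.
have := @measurability _ _ T (box_measurable R I) setT (fun w i => X i w) (boxes R I) erefl.
apply => _ [_ [B mB <-] <-].
rewrite setTI; apply: measurable_forall_fin => i.
exact: measurable_preimage.
Qed.

(** The two families may live on different probability spaces; this is how statements pass between
    [T] and [T * T], where an independent copy is available. *)
Lemma iid_normal_law (R : realType) (I : finType) (d1 d2 : measure_display)
    (T1 : measurableType d1) (T2 : measurableType d2)
    (P1 : probability T1 R) (P2 : probability T2 R)
    (X1 : I -> T1 -> R) (X2 : I -> T2 -> R) (S : set (box_measurable R I)) :
  iid_normal P1 X1 -> iid_normal P2 X2 -> measurable S ->
  P1 [set w | S (fun i => X1 i w)] = P2 [set w | S (fun i => X2 i w)].
Proof.
move=> [mX1 PX1] [mX2 PX2] mS.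
pose m1 := image_measure P1 (measurable_box_family mX1).
pose m2 := image_measure P2 (measurable_box_family mX2).
suff : m1 S = m2 S by [].
refine (@measure_unique _ R (box_measurable R I) (boxes R I) (fun=> setT)
  erefl _ _ _ m1 m2 _ _ S mS).
- move=> _ _ [A mA <-] [B mB <-]; exists (fun i => A i `&` B i).
    by move=> i; exact: measurableI.
  apply/seteqP; split => x /=; first by move=> h; split => i; have [] := h i.
  by move=> [h1 h2] i; split.
- by move=> _; exists (fun=> setT) => //; apply/seteqP; split.
- by rewrite bigcup_const.
- move=> _ [B mB <-]; transitivity (P1 [set w | forall i, B i (X1 i w)]) => //.
  by rewrite PX1 // -PX2.
- move=> _; have -> : m1 setT = P1 setT by [].
  by rewrite probability_setT ltry.
Qed.

Lemma in_bigsetI {T : Type} {I : finType} (Q : pred I) (F : I -> set T) (w : T) :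
  (\big[setI/setT]_(i | Q i) F i) w <-> forall i, Q i -> F i w.
Proof.
have -> : (\big[setI/setT]_(i | Q i) F i) w <->
    forall i, i \in index_enum I -> Q i -> F i w.
  elim: (index_enum I) => [|a r IH]; first by rewrite big_nil; split.
  rewrite big_cons; case: ifPn => Qa.
    split=> [[Fa /IH h] i|h].
      by rewrite inE => /predU1P[->//|]; exact: h.
    split; first by apply: h => //; rewrite mem_head.
    by apply/IH => i ir; apply: h; rewrite inE ir orbT.
  rewrite IH; split=> h i.
    by rewrite inE => /predU1P[->|/h//]; rewrite (negbTE Qa).
  by move=> ir; apply: h; rewrite inE ir orbT.
by split=> h i => [Qi|_ Qi]; apply: h => //; rewrite mem_index_enum.
Qed.

(** * Plane rotations of Gaussian matrices *)

Section matrices.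
Context {R : realType} {n : nat}.
Implicit Types (A M : 'M[R]_n) (a b : 'I_n) (c s : R).

Definition givens_act a b c s (v : 'I_n -> R) (i : 'I_n) : R :=
  if i == a then c * v a - s * v b
  else if i == b then s * v a + c * v b else v i.

Definition givens a b c s : 'M[R]_n :=
  \matrix_(i, j) givens_act a b c s (fun k => (k == j)%:R) i.

Lemma givens_mulE a b c s (m : nat) (M : 'M[R]_(n, m)) i j :
  (givens a b c s *m M) i j = givens_act a b c s (fun k => M k j) i.
Proof.
have delta k : \sum_l (k == l)%:R * M l j = M k j.
  rewrite (bigD1 k) //= eqxx mul1r big1 ?addr0 // => l lk.
  by rewrite eq_sym (negbTE lk) mul0r.
rewrite mxE /givens_act; have [->|ia] := eqVneq i a.
  under eq_bigr do rewrite mxE /givens_act eqxx mulrBl -!mulrA.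
  by rewrite sumrB -!mulr_sumr !delta.
have [eib|ib] := eqVneq i b.
  rewrite eib in ia *.
  under eq_bigr do rewrite mxE /givens_act (negbTE ia) eqxx mulrDl -!mulrA.
  by rewrite big_split /= -!mulr_sumr !delta.
under eq_bigr do rewrite mxE /givens_act (negbTE ia) (negbTE ib).
by rewrite delta.
Qed.

Lemma givens_trmx a b c s : a != b -> (givens a b c s)^T = givens a b c (- s).
Proof.
move=> ab; apply/matrixP => i j; rewrite !mxE /givens_act.
have ba : b != a by rewrite eq_sym.
have [->|ia] := eqVneq i a; have [->|ja] := eqVneq j a;
  rewrite ?eqxx ?(negbTE ab) ?(negbTE ba) ?mulr1n ?mulr0n; try by ring.
- by have [_|_] := eqVneq j b; rewrite /= ?mulr1n ?mulr0n; ring.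
- by have [_|_] := eqVneq i b; rewrite /= ?(negbTE ia) ?mulr1n ?mulr0n; ring.
have [eib|ib] := eqVneq i b; have [ejb|jb] := eqVneq j b;
  rewrite /= ?mulr1n ?mulr0n; try by ring.
- by rewrite eib (negbTE jb) mulr0n; ring.
- by rewrite ejb (negbTE ib) mulr0n; ring.
by rewrite eq_sym.
Qed.

Lemma givens_orthogonal a b c s : a != b -> c ^+ 2 + s ^+ 2 = 1 ->
  (givens a b c s)^T *m givens a b c s = 1%:M.
Proof.
move=> ab cs; rewrite givens_trmx //; apply/matrixP => i j.
have ba : b != a by rewrite eq_sym.
rewrite givens_mulE mxE /givens_act !mxE /givens_act.
have [->|ia] := eqVneq i a; rewrite ?eqxx ?(negbTE ba) ?(negbTE ab).
  transitivity ((c ^+ 2 + s ^+ 2) * (a == j)%:R); first by ring.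
  by rewrite cs mul1r.
have [->|ib] := eqVneq i b; rewrite ?eqxx ?(negbTE ba) ?(negbTE ab).
  transitivity ((c ^+ 2 + s ^+ 2) * (b == j)%:R); first by ring.
  by rewrite cs mul1r.
by rewrite ?(negbTE ia) ?(negbTE ib).
Qed.

(** Turns a matrix of independent standard normal entries into a GOE matrix: variance 1 off the
    diagonal, and (2 / sqrt 2)^2 = 2 on it. It commutes with orthogonal conjugation, so invariance
    can be proved on independent entries. *)
Definition sym_mx M : 'M[R]_n := (Num.sqrt 2)^-1 *: (M + M^T).

Lemma sym_mx_conj (O M : 'M[R]_n) :
  sym_mx (O *m M *m O^T) = O *m sym_mx M *m O^T.
Proof.
rewrite /sym_mx -scalemxAr -scalemxAl !trmx_mul trmxK mulmxDr mulmxDl.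
by rewrite mulmxA.
Qed.

Definition iid_normal_mx {d : measure_display} {T : measurableType d}
    (P : probability T R) (Y : T -> 'M[R]_n) : Prop :=
  iid_normal P (fun (p : 'I_n * 'I_n) w => Y w p.1 p.2).

(* Quantifying over all random matrices avoids a sigma-algebra on 'M[R]_n. *)
Definition event (S : set 'M[R]_n) : Prop :=
  forall (d : measure_display) (T : measurableType d) (A : T -> 'M[R]_n),
    (forall i j, measurable_fun setT (fun w => A w i j)) ->
    measurable [set w | S (A w)].

Section law.
Context {d : measure_display} {T : measurableType d}.
Variable P : probability T R.
Implicit Types Y : T -> 'M[R]_n.

Lemma iid_normal_mx_tr Y : iid_normal_mx P Y -> iid_normal_mx P (fun w => (Y w)^T).
Proof.
move=> iY.
have := @iid_normal_reindex _ _ _ P _ _ _ (fun p : 'I_n * 'I_n => (p.2, p.1)) _ iY.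
have inj : injective (fun p : 'I_n * 'I_n => (p.2, p.1)).
  by move=> [i j] [k l] [-> ->].
move=> /(_ inj); congr iid_normal.
by apply/funext => -[i j]; apply/funext => w; rewrite mxE.
Qed.

Lemma iid_normal_mx_givens Y a b c s : a != b -> s != 0 ->
  c ^+ 2 + s ^+ 2 = 1 -> iid_normal_mx P Y ->
  iid_normal_mx P (fun w => givens a b c s *m Y w).
Proof.
move=> ab s0 cs iY.
pose sg (p : 'I_n * 'I_n) := (tperm a b p.1, p.2).
have sgK : involutive sg by move=> [i j]; rewrite /sg /= tpermK.
have Asg (p : 'I_n * 'I_n) : p.1 == a -> (sg p).1 != a.
  by move=> /eqP /= ->; rewrite tpermL eq_sym.
have := iid_normal_rotate (A := fun p => p.1 == a) sgK Asg s0 cs iY.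
congr iid_normal; apply/funext => -[i j]; apply/funext => w /=.
rewrite givens_mulE /givens_act; have [->|ia] := eqVneq i a.
  by rewrite tpermL.
have [->|ib] := eqVneq i b; first by rewrite tpermR eqxx.
have ai : a != i by rewrite eq_sym.
have bi : b != i by rewrite eq_sym.
by rewrite (tpermD ai bi) (negbTE ia).
Qed.

Lemma iid_normal_mx_conj Y a b c s : a != b -> s != 0 ->
  c ^+ 2 + s ^+ 2 = 1 -> iid_normal_mx P Y ->
  iid_normal_mx P (fun w => givens a b c s *m Y w *m (givens a b c s)^T).
Proof.
move=> ab s0 cs iY.
have {iY} := iid_normal_mx_givens ab s0 cs iY.
move=> /iid_normal_mx_tr /(iid_normal_mx_givens ab s0 cs) /iid_normal_mx_tr.
congr iid_normal_mx; apply/funext => w.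
by rewrite trmx_mul !trmxK.
Qed.

Lemma iid_normal_mx_law Y Y' (S : set 'M[R]_n) : event S ->
  iid_normal_mx P Y -> iid_normal_mx P Y' ->
  P [set w | S (sym_mx (Y w))] = P [set w | S (sym_mx (Y' w))].
Proof.
move=> eS iY iY'.
pose mx (x : box_measurable R ('I_n * 'I_n)%type) : 'M[R]_n :=
  \matrix_(i, j) x (i, j).
have mS : measurable [set x : box_measurable R ('I_n * 'I_n)%type | S (sym_mx (mx x))].
  apply: eS => i j.
  have -> : (fun w => sym_mx (mx w) i j) =
      (fun w => (Num.sqrt 2)^-1 * (w (i, j) + w (j, i))).
    by apply/funext => w; rewrite !mxE.
  apply: measurable_funM => //; apply: measurable_funD;
    exact: measurable_box_coord.
have := iid_normal_law iY iY' mS.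
have mxE' (Z : T -> 'M[R]_n) w : mx (fun p => Z w p.1 p.2) = Z w.
  by apply/matrixP => i j; rewrite mxE.
by rewrite /=; under eq_set do rewrite mxE'; under [in RHS]eq_set do rewrite mxE'.
Qed.

End law.
End matrices.

(** * Measurability of existential events *)

Section regular.
Context {R : realType}.

(** A syntactic class, so that one membership proof yields both measurability in random arguments
    and continuity along filters. Absolute values are included so that inequalities can be encoded
    as zero sets. *)
Inductive regular {I : Type} : ((I -> R) -> R) -> Prop :=
| regular_cst (a : R) : regular (fun=> a)
| regular_coord (i : I) : regular (fun x => x i)
| regular_add f g : regular f -> regular g -> regular (fun x => f x + g x)
| regular_mul f g : regular f -> regular g -> regular (fun x => f x * g x)
| regular_norm f : regular f -> regular (fun x => `|f x|).

Section closure.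
Context {I : Type}.
Implicit Types f g : (I -> R) -> R.

Lemma regular_opp f : regular f -> regular (fun x => - f x).
Proof.
move=> rf; have := regular_mul (regular_cst (-1)) rf.
by under eq_fun do rewrite mulN1r.
Qed.

Lemma regular_sub f g : regular f -> regular g -> regular (fun x => f x - g x).
Proof. by move=> rf rg; apply: regular_add => //; exact: regular_opp. Qed.

Lemma regular_sum (J : Type) (r : seq J) (Q : pred J) (F : J -> (I -> R) -> R) :
  (forall j, regular (F j)) -> regular (fun x => \sum_(j <- r | Q j) F j x).
Proof.
move=> rF; elim: r => [|j r IH].
  by under eq_fun do rewrite big_nil; exact: regular_cst.
under eq_fun do rewrite big_cons.
by case: (Q j) => //; exact: regular_add.
Qed.

Lemma regular_prod (J : Type) (r : seq J) (Q : pred J) (F : J -> (I -> R) -> R) :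
  (forall j, regular (F j)) -> regular (fun x => \prod_(j <- r | Q j) F j x).
Proof.
move=> rF; elim: r => [|j r IH].
  by under eq_fun do rewrite big_nil; exact: regular_cst.
under eq_fun do rewrite big_cons.
by case: (Q j) => //; exact: regular_mul.
Qed.

Lemma regular_mulmx (m n k : nat) (A : (I -> R) -> 'M[R]_(m, n))
    (B : (I -> R) -> 'M[R]_(n, k)) :
  (forall i j, regular (fun x => A x i j)) ->
  (forall i j, regular (fun x => B x i j)) ->
  forall i j, regular (fun x => (A x *m B x) i j).
Proof.
move=> rA rB i j; under eq_fun do rewrite mxE.
by apply: regular_sum => l; exact: regular_mul.
Qed.

Lemma regular_det (n : nat) (A : (I -> R) -> 'M[R]_n) :
  (forall i j, regular (fun x => A x i j)) -> regular (fun x => \det (A x)).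
Proof.
move=> rA; apply: regular_sum => s; apply: regular_mul; first exact: regular_cst.
by apply: regular_prod => i; exact: rA.
Qed.

Lemma measurable_regular (d : measure_display) (T : measurableType d)
    (X : I -> T -> R) f :
  (forall i, measurable_fun setT (X i)) -> regular f ->
  measurable_fun setT (fun w => f (fun i => X i w)).
Proof.
move=> mX; elim=> {f} [a|i|f g _ mf _ mg|f g _ mf _ mg|f _ mf] //.
- exact: measurable_funD.
- exact: measurable_funM.
- exact: measurableT_comp.
Qed.

Lemma cvg_regular (T : Type) (FF : set_system T) (v : I -> T -> R) (V : I -> R) f :
  Filter FF -> (forall i, v i x @[x --> FF] --> V i) -> regular f ->
  f (fun i => v i x) @[x --> FF] --> f V.
Proof.
move=> FFF cv; elim=> {f} [a|i|f g _ cf _ cg|f g _ cf _ cg|f _ cf] //.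
- exact: cvg_cst.
- exact: cvgD.
- exact: cvgM.
- exact: cvg_norm.
Qed.
End closure.

Lemma regular_comp (I J : Type) (f : (J -> R) -> R) (g : J -> (I -> R) -> R) :
  regular f -> (forall j, regular (g j)) -> regular (fun x => f (fun j => g j x)).
Proof.
move=> rf rg; elim: rf => {f} [a|i|f h _ rf _ rh|f h _ rf _ rh|f _ rf] //.
- exact: regular_cst.
- exact: regular_add.
- exact: regular_mul.
- exact: regular_norm.
Qed.

Lemma regular_neq0_ball (I : finType) (f : (I -> R) -> R) (V : I -> R) :
  regular f -> f V != 0 ->
  exists2 e, 0 < e & forall x, (forall i, `|x i - V i| < e) -> f x != 0.
Proof.
move=> rf fV; apply: contrapT => H.
have hx (k : nat) : exists x : I -> R,
    (forall i, `|x i - V i| < k.+1%:R^-1) /\ f x = 0.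
  apply: contrapT => Hk; apply: H; exists (k.+1%:R^-1).
    by rewrite invr_gt0.
  by move=> x xV; apply/eqP => fx; apply: Hk; exists x.
have [x hxk] := choice hx.
have cx i : x k i @[k --> \oo] --> V i.
  apply/cvgrPdist_lt => e e0; near=> k; rewrite distrC.
  apply: (lt_trans ((hxk k).1 i)); near: k.
  exact: near_infty_natSinv_lt (PosNum e0).
have cf : (fun k => f (x k)) @ \oo --> f V.
  exact: (cvg_regular (v := fun i k => x k i) _ cx rf).
have E : (fun k => f (x k)) = cst 0 by apply/funext => k; exact: (hxk k).2.
rewrite E in cf; move: fV; rewrite (cvg_unique _ cf (cvg_cst _)) ?eqxx //.
Unshelve. all: by end_near.
Qed.
End regular.

Section closed_selection.
Context {R : realType}.

(* This is what makes an existential over a compact set measurable. Compactness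
   enters through an ultrafilter refining \oo, along which every bounded
   coordinate converges. *)
Lemma bounded_zero_rational (I : finType) (F : (I -> R) -> R) :
  (forall V, 0 <= F V) ->
  (forall (T : Type) (FF : set_system T) (v : I -> T -> R) (V : I -> R),
     Filter FF -> (forall i, v i x @[x --> FF] --> V i) ->
     F (fun i => v i x) @[x --> FF] --> F V) ->
  (forall V, F V = 0 -> forall i, `|V i| <= 1) ->
  (exists V, F V = 0) <->
  (forall m : nat, exists q : {ffun I -> rat},
     (forall i, `|ratr (q i) : R| <= 2) /\ F (fun i => ratr (q i)) < m.+1%:R^-1).
Proof.
move=> F0 Fc FB; split=> [[V FV] m|H].
  have V1 := FB V FV.
  have qP (k : nat) (i : I) : exists q : rat, `|V i - ratr q| < k.+1%:R^-1.
    have k0 : 0 < (k.+1%:R^-1 : R) by rewrite invr_gt0.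
    have lt : V i - k.+1%:R^-1 < V i + k.+1%:R^-1.
      by rewrite ltrBlDr -addrA ltrDl addr_gt0.
    have [q /itvP qI] := rat_in_itvoo lt.
    by exists q; rewrite distrC ltr_distl !qI.
  have [q hq] := choice (fun ki : nat * I => qP ki.1 ki.2).
  have cq i : (ratr (q (k, i)) : R) @[k --> \oo] --> V i.
    apply/cvgrPdist_lt => e e0; near=> k.
    apply: (lt_le_trans (hq (k, i))) => /=; apply: ltW.
    near: k; exact: near_infty_natSinv_lt (PosNum e0).
  have /cvgrPdist_lt Fq : F (fun i => ratr (q (k, i))) @[k --> \oo] --> 0.
    by rewrite -FV; exact: (Fc nat _ _ V _ cq).
  have m0 : 0 < (m.+1%:R^-1 : R) by rewrite invr_gt0.
  have : \forall k \near \oo, F (fun i => ratr (q (k, i))) < m.+1%:R^-1 /\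
      (k.+1%:R^-1 : R) < 1.
    near=> k; split.
      have : `|0 - F (fun i => ratr (q (k, i)))| < m.+1%:R^-1.
        by near: k; exact: Fq.
      by rewrite sub0r normrN ger0_norm.
    by near: k; exact: near_infty_natSinv_lt (PosNum (@ltr01 R)).
  case/filter_ex => k [Fk k1]; exists [ffun i => q (k, i)]; split=> [i|].
    (* The approximants are within 1 of [V], whose coordinates are at most 1 in absolute value;
       hence the bound 2. *)
    rewrite ffunE -[X in `|X|](subKr (V i)) (le_trans (ler_normB _ _)) //.
    rewrite (_ : 2 = 1 + 1) // lerD // ltW // (lt_trans (hq (k, i))) //.
  by under eq_fun do rewrite ffunE.
have [q hq] := choice H.
have [U [UU sU]] := ultraFilterLemma eventually_filter.
have limP i : exists V : R, (fun m : nat => ratr (q m i) : R) @ U --> V.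
  have := @segment_compact R (- 2) 2.
  move=> /(_ ((fun m : nat => ratr (q m i) : R) @ U) _) [].
    apply: (@filterE _ U _ ((fun m : nat => ratr (q m i) : R) @^-1` `[-2, 2])).
    move=> m /=; have [/(_ i) + _] := hq m.
    by rewrite ler_norml in_itv.
  move=> V [_ clV]; exists V => N NV /=.
  have [//|nN] := in_ultra_setVsetC ((fun m : nat => ratr (q m i) : R) @^-1` N) UU.
  by have [x []] := clV (~` N) N nN NV.
have UF : Filter U by typeclasses eauto.
have [V cV] := choice limP; exists V.
have cF := Fc _ _ _ V _ cV.
apply/eqP; rewrite eq_le F0 andbT; apply/ler_addgt0Pr => e e0; rewrite add0r.
have FU : (fun m : nat => F (fun i => ratr (q m i))) @ U --> F V := cF UF.
rewrite leNgt; apply/negP => eF.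
have h1 : U [set m | e < F (fun i => ratr (q m i))] := cvgr_gt _ FU _ eF.
have h2 : U [set m | F (fun i => ratr (q m i)) < e].
  apply: sU; near=> k; have [_ Fk] := hq k.
  by apply: lt_trans Fk _; near: k; exact: near_infty_natSinv_lt (PosNum e0).
have [k [/= k1 k2]] := filter_ex (filterI (h1 UF) h2).
by have := lt_trans k1 k2; rewrite ltxx.
Unshelve. all: by end_near.
Qed.
End closed_selection.

(** * Moments of Rademacher chaoses *)

Section sign_chaos.
Context {R : realType}.
Implicit Types (x y : R) (p n : nat).

(* Entries of index at least n are 0. *)
Fixpoint signs n : seq (nat -> R) :=
  if n is m.+1 then
    [seq (fun i => if i == m then 1 else e i) | e <- signs m] ++
    [seq (fun i => if i == m then -1 else e i) | e <- signs m]
  else [:: fun=> 0].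

Lemma size_signs n : size (signs n) = (2 ^ n)%N.
Proof. by elim: n => //= n IH; rewrite size_cat !size_map IH addnn expnS mul2n. Qed.

Lemma signs_sqr n e i : e \in signs n -> (i < n)%N -> e i ^+ 2 = 1.
Proof.
elim: n e => // n IH e /=; rewrite mem_cat ltnS leq_eqVlt.
case/orP => /mapP[e' he' ->]; have [->|_] //= := eqVneq i n;
  rewrite ?expr1n ?sqrrN ?expr1n //; exact: IH.
Qed.

Lemma sum_signsS n (F : (nat -> R) -> R) :
  \sum_(e <- signs n.+1) F e =
  \sum_(e <- signs n) (F (fun i => if i == n then 1 else e i) +
                       F (fun i => if i == n then -1 else e i)).
Proof. by rewrite /= big_cat /= !big_map big_split. Qed.

Lemma exprn_convex p x y (t : R) : 0 <= x -> 0 <= y -> 0 <= t <= 1 ->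
  (t * x + (1 - t) * y) ^+ p <= t * x ^+ p + (1 - t) * y ^+ p.
Proof.
move=> x0 y0 /andP[t0 t1]; elim: p => [|p IH].
  by rewrite !expr0 !mulr1 addrC subrK.
have m0 : 0 <= t * x + (1 - t) * y by rewrite addr_ge0 // mulr_ge0 // subr_ge0.
rewrite exprS (le_trans (ler_wpM2l m0 IH)) // -subr_ge0.
(* The difference reduces to (x - y) (x^p - y^p), whose factors have the same sign. *)
have -> : t * x ^+ p.+1 + (1 - t) * y ^+ p.+1 -
  (t * x + (1 - t) * y) * (t * x ^+ p + (1 - t) * y ^+ p) =
  t * (1 - t) * ((x - y) * (x ^+ p - y ^+ p)) by rewrite !exprS; ring.
apply: mulr_ge0; first by rewrite mulr_ge0 // subr_ge0.
have [xy|/ltW xy] := leP x y.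
  by rewrite mulr_le0 // subr_le0 // lerXn2r // nnegrE.
by rewrite mulr_ge0 // subr_ge0 // lerXn2r // nnegrE.
Qed.

(** Minkowski's inequality without p-th roots: convexity of the power, with weights a / (a + b) and
    b / (a + b), applied to U / a and V / b. When [a] or [b] is 0 the corresponding function
    vanishes on [r]. *)
Lemma sum_expr_minkowski (T : choiceType) (r : seq T) (U V : T -> R) (a b : R) p :
  (0 < p)%N -> (forall t, 0 <= U t) -> (forall t, 0 <= V t) -> 0 <= a -> 0 <= b ->
  \sum_(t <- r) U t ^+ p <= a ^+ p * (size r)%:R ->
  \sum_(t <- r) V t ^+ p <= b ^+ p * (size r)%:R ->
  \sum_(t <- r) (U t + V t) ^+ p <= (a + b) ^+ p * (size r)%:R.
Proof.
move=> p0 U0 V0.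
have zero (W : T -> R) : (forall t, 0 <= W t) ->
    \sum_(t <- r) W t ^+ p <= 0 ^+ p * (size r)%:R ->
    forall t, t \in r -> W t = 0.
  move=> W0; rewrite expr0n gtn_eqF // mul0r => h t tr.
  have : \sum_(t <- r) W t ^+ p == 0.
    by rewrite eq_le h sumr_ge0 // => i _; exact: exprn_ge0.
  rewrite psumr_eq0; last by move=> i _; exact: exprn_ge0.
  by move=> /allP/(_ t tr); rewrite implyTb expf_eq0 p0 => /eqP.
rewrite le_eqVlt => /predU1P[<-|a0]; rewrite le_eqVlt => /predU1P[<-|b0] hU hV.
- rewrite addr0 [leLHS]big_seq big1 ?mulr_ge0 ?exprn_ge0 // => t tr.
  by rewrite (zero U) // (zero V) // addr0 expr0n gtn_eqF.
- rewrite add0r (le_trans _ hV) // !big_seq ler_sum // => t tr.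
  by rewrite (zero U) // add0r.
- rewrite addr0 (le_trans _ hU) // !big_seq ler_sum // => t tr.
  by rewrite (zero V) // addr0.
have ab0 : 0 < a + b by rewrite addr_gt0.
pose th := a / (a + b).
have th0 : 0 <= th by rewrite divr_ge0 // ltW.
have th1 : th <= 1 by rewrite ler_pdivrMr // mul1r lerDl ltW.
have thE : 1 - th = b / (a + b) by rewrite /th; field; rewrite gt_eqF.
have key t : (U t + V t) ^+ p <=
    (a + b) ^+ p * (th * (U t ^+ p / a ^+ p) + (1 - th) * (V t ^+ p / b ^+ p)).
  have -> : U t + V t = (a + b) * (th * (U t / a) + (1 - th) * (V t / b)).
    by rewrite thE /th; field; rewrite !gt_eqF.
  rewrite exprMn; apply: ler_wpM2l; first by rewrite exprn_ge0 // ltW.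
  rewrite -(expr_div_n _ a) -(expr_div_n _ b).
  apply: exprn_convex; last by rewrite th0.
    by rewrite divr_ge0 // ltW.
  by rewrite divr_ge0 // ltW.
apply: le_trans (ler_sum _ (fun t _ => key t)) _.
rewrite -mulr_sumr; apply: ler_wpM2l; first by rewrite exprn_ge0 // ltW.
rewrite big_split /= -!mulr_sumr -!mulr_suml.
have -> : (size r)%:R = th * (size r)%:R + (1 - th) * (size r)%:R by ring.
rewrite lerD // ler_wpM2l ?subr_ge0 // ler_pdivrMr ?exprn_gt0 // mulrC //.
Qed.

(** The two-point hypercontractive inequality of Bonami for even exponents. The sharp constant is 2p
    - 1; the weaker 4p + 1 admits a short induction. *)
Lemma two_point p x y :
  (x + y) ^+ (2 * p) + (x - y) ^+ (2 * p) <=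
  2 * (x ^+ 2 + (4 * p + 1)%:R * y ^+ 2) ^+ p.
Proof.
set c : R := (4 * p + 1)%:R; set B := x ^+ 2 + c * y ^+ 2.
have B0 : 0 <= B by rewrite addr_ge0 ?sqr_ge0 // mulr_ge0 ?sqr_ge0 ?ler0n.
have xB : x ^+ 2 <= B by rewrite lerDl mulr_ge0 ?sqr_ge0 ?ler0n.
have y0 := sqr_ge0 y.
(* [B] stays fixed, with the final [p] in it, while the exponent [m] grows. Raising [m] mixes the
   sum of the two powers with their difference times 2xy, so both are bounded together; the first
   bound needs x^2 + y^2 + 4 m y^2 <= B, the source of 4p + 1. *)
suff /(_ p (leqnn p)) [] : forall m, (m <= p)%N ->
    (x + y) ^+ (2 * m) + (x - y) ^+ (2 * m) <= 2 * B ^+ m /\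
    2 * x * y * ((x + y) ^+ (2 * m) - (x - y) ^+ (2 * m)) <=
      8 * m%:R * y ^+ 2 * B ^+ m by [].
elim=> [|m IH] mp; first by rewrite !muln0 !expr0; split; lra.
have [IHa IHb] := IH (ltnW mp).
have sB : x ^+ 2 + y ^+ 2 + 4 * m%:R * y ^+ 2 <= B.
  rewrite /B /c natrD natrM.
  have : (m%:R : R) <= p%:R by rewrite ler_nat ltnW.
  by move=> mpR; nra.
have m0 : 0 <= (m%:R : R) by rewrite ler0n.
have BB0 : 0 <= B ^+ m by rewrite exprn_ge0.
have n4 : 0 <= 4 :> R by rewrite ler0n.
have n8 : 0 <= 8 :> R by rewrite ler0n.
have e2 (z : R) : z ^+ (2 * m.+1) = z ^+ 2 * z ^+ (2 * m) by rewrite mulnS exprD.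
rewrite !e2 [B ^+ m.+1]exprS -[m.+1%:R]natr1.
move: IHa IHb; set u := (x + y) ^+ (2 * m); set v := (x - y) ^+ (2 * m).
set W := B ^+ m in BB0 *; move=> IHa IHb; split.
  have -> : (x + y) ^+ 2 * u + (x - y) ^+ 2 * v =
    (x ^+ 2 + y ^+ 2) * (u + v) + 2 * x * y * (u - v) by ring.
  have h1 : (x ^+ 2 + y ^+ 2) * (u + v) <= (x ^+ 2 + y ^+ 2) * (2 * W).
    by rewrite ler_wpM2l // addr_ge0 ?sqr_ge0.
  apply: le_trans (lerD h1 IHb) _.
  have := ler_wpM2r BB0 sB; lra.
have -> : 2 * x * y * ((x + y) ^+ 2 * u - (x - y) ^+ 2 * v) =
  (x ^+ 2 + y ^+ 2) * (2 * x * y * (u - v)) + 4 * (x ^+ 2 * y ^+ 2) * (u + v) by ring.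
have sB' : x ^+ 2 + y ^+ 2 <= B.
  by apply: le_trans sB; rewrite lerDl mulr_ge0 // mulr_ge0.
have s0 : 0 <= x ^+ 2 + y ^+ 2 by rewrite addr_ge0 ?sqr_ge0.
have h1 := ler_wpM2l s0 IHb.
have h2 : 4 * (x ^+ 2 * y ^+ 2) * (u + v) <= 4 * (x ^+ 2 * y ^+ 2) * (2 * W).
  by apply: ler_wpM2l => //; rewrite !(sqr_ge0, mulr_ge0).
apply: le_trans (lerD h1 h2) _.
have K0 : 0 <= 8 * m%:R * y ^+ 2 * W by rewrite !(sqr_ge0, ler0n, exprn_ge0, mulr_ge0).
have h3 := ler_wpM2r K0 sB'.
have K1 : 0 <= 8 * y ^+ 2 * W by rewrite !(sqr_ge0, ler0n, exprn_ge0, mulr_ge0).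
have h4 := ler_wpM2r K1 xB.
lra.
Qed.

Variable p : nat.
Hypothesis p0 : (0 < p)%N.
Let c : R := (4 * p + 1)%:R.
Let c0 : 0 <= c. Proof. exact: ler0n. Qed.

(** Khintchine's inequality. The last sign is averaged out by [two_point], leaving a p-th moment of
    the square of the shorter form plus a constant, which Minkowski's inequality separates. *)
Lemma sum_signs_linear (a : nat -> R) n :
  \sum_(e <- signs n) (\sum_(i < n) a i * e i) ^+ (2 * p) <=
  (c * \sum_(i < n) a i ^+ 2) ^+ p * (2 ^ n)%:R.
Proof.
elim: n => [|n IH].
  by rewrite big_seq1 !big_ord0 mulr0 !expr0n muln_eq0 /= (gtn_eqF p0) mul0r.
rewrite sum_signsS.
pose L (e : nat -> R) := \sum_(i < n) a i * e i.
apply: (@le_trans _ _ (\sum_(e <- signs n) 2 * (L e ^+ 2 + c * a n ^+ 2) ^+ p)).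
  apply: ler_sum => e _; apply: le_trans (two_point p (L e) (a n)).
  have Le (z : R) : \sum_(i < n.+1) a i * (if i == n :> nat then z else e i) =
      L e + a n * z.
    rewrite big_ord_recr /= eqxx; congr (_ + _); apply: eq_bigr => i _.
    by rewrite ltn_eqF.
  by rewrite !Le mulr1 mulrN1.
have -> : (2 ^ n.+1)%:R = 2 * (2 ^ n)%:R :> R by rewrite expnS natrM.
rewrite -mulr_sumr [leRHS]mulrCA; apply: ler_wpM2l => //; rewrite big_ord_recr /= mulrDr.
rewrite -size_signs; apply: sum_expr_minkowski => //.
- by move=> e; exact: sqr_ge0.
- by move=> e; rewrite mulr_ge0 ?sqr_ge0.
- by rewrite mulr_ge0 // sumr_ge0 // => i _; exact: sqr_ge0.
- by rewrite mulr_ge0 ?sqr_ge0.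
- rewrite size_signs; apply: le_trans IH; rewrite le_eqVlt; apply/orP; left.
  by apply/eqP; apply: eq_bigr => e _; rewrite exprM.
- by rewrite big_const_seq count_predT iter_addr addr0 mulr_natr.
Qed.

(** The same induction, where the coefficient of the last sign is now a linear form in the others:
    one factor [c] comes from [two_point] and a second one from the linear case. *)
Lemma sum_signs_quadratic (a : nat -> nat -> R) n :
  \sum_(e <- signs n) (\sum_(j < n) e j * \sum_(i < j) a i j * e i) ^+ (2 * p) <=
  (c ^+ 2 * \sum_(j < n) \sum_(i < j) a i j ^+ 2) ^+ p * (2 ^ n)%:R.
Proof.
elim: n => [|n IH].
  by rewrite big_seq1 !big_ord0 mulr0 !expr0n muln_eq0 /= (gtn_eqF p0) mul0r.
rewrite sum_signsS.
pose Q (e : nat -> R) := \sum_(j < n) e j * \sum_(i < j) a i j * e i.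
pose L (e : nat -> R) := \sum_(i < n) a i n * e i.
apply: (@le_trans _ _ (\sum_(e <- signs n) 2 * (Q e ^+ 2 + c * L e ^+ 2) ^+ p)).
  apply: ler_sum => e _; apply: le_trans (two_point p (Q e) (L e)).
  have Qe (z : R) : \sum_(j < n.+1) (if j == n :> nat then z else e j) *
      (\sum_(i < j) a i j * (if i == n :> nat then z else e i)) = Q e + z * L e.
    rewrite big_ord_recr /= eqxx; congr (_ + z * _).
      apply: eq_bigr => j _; rewrite ltn_eqF //; congr (_ * _).
      by apply: eq_bigr => i _; rewrite ltn_eqF // (ltn_trans (ltn_ord i)).
    by apply: eq_bigr => i _; rewrite ltn_eqF.
  by rewrite !Qe mul1r mulN1r.
have -> : (2 ^ n.+1)%:R = 2 * (2 ^ n)%:R :> R by rewrite expnS natrM.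
rewrite -mulr_sumr [leRHS]mulrCA; apply: ler_wpM2l => //; rewrite big_ord_recr /= mulrDr.
rewrite -size_signs; apply: sum_expr_minkowski => //.
- by move=> e; exact: sqr_ge0.
- by move=> e; rewrite mulr_ge0 ?sqr_ge0.
- rewrite mulr_ge0 ?sqr_ge0 // sumr_ge0 // => j _.
  by rewrite sumr_ge0 // => i _; exact: sqr_ge0.
- by rewrite mulr_ge0 ?sqr_ge0 // sumr_ge0 // => i _; exact: sqr_ge0.
- rewrite size_signs; apply: le_trans IH; rewrite le_eqVlt; apply/orP; left.
  by apply/eqP; apply: eq_bigr => e _; rewrite exprM.
- rewrite size_signs.
  have -> : \sum_(e <- signs n) (c * L e ^+ 2) ^+ p =
      c ^+ p * \sum_(e <- signs n) L e ^+ (2 * p).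
    by rewrite mulr_sumr; apply: eq_bigr => e _; rewrite exprMn exprM.
  set s := \sum_(i < n) _.
  have -> : (c ^+ 2 * s) ^+ p * (2 ^ n)%:R = c ^+ p * ((c * s) ^+ p * (2 ^ n)%:R).
    by rewrite mulrA -exprMn mulrA -expr2.
  by apply: ler_wpM2l; [rewrite exprn_ge0|exact: (sum_signs_linear (fun i => a i n) n)].
Qed.
End sign_chaos.

(** * Orthogonal invariance of GOE *)

Section goe_law.
Context {R : realType} {n : nat} {d : measure_display} {T : measurableType d}.
Variables (P : probability T R) (G : 'I_n -> 'I_n -> T -> R).
Hypothesis GG : is_GOE P G.

Definition upper (m : nat) := {p : 'I_m * 'I_m | (p.1 <= p.2)%N}.

Definition goe_std (i : upper n) (w : T) : R :=
  G (val i).1 (val i).2 w / goe_sd (val i).1 (val i).2.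

Lemma goe_sd_gt0 (i j : 'I_n) : 0 < goe_sd i j :> R.
Proof. by rewrite /goe_sd; case: ifP => // _; rewrite sqrtr_gt0. Qed.

Lemma goe_std_iid : iid_normal P goe_std.
Proof.
have [mG symG normG indG] := GG; split=> [i|B mB].
  by apply: measurable_funM.
pose S : {set 'I_n * 'I_n} := [set p : 'I_n * 'I_n | (p.1 <= p.2)%N]%SET.
pose B' (p : 'I_n * 'I_n) : set R :=
  if insub p is Some i then (fun x => x / goe_sd p.1 p.2) @^-1` B i else setT.
have B'val (i : upper n) :
    B' (val i) = (fun x => x / goe_sd (val i).1 (val i).2) @^-1` B i.
  by rewrite /B' valK.
have mB' p : measurable (B' p).
  rewrite /B'; case: insubP => [i _ _|_] //.
  rewrite -[X in measurable X]setTI; exact: (mulrr_measurable _^-1).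
have SS p : p \in S -> (p.1 <= p.2)%N by rewrite inE.
have -> : [set w | forall i, B i (goe_std i w)] =
    \big[setI/setT]_(p in S) (G p.1 p.2 @^-1` B' p).
  apply/seteqP; split => w /=.
    move=> h; apply/in_bigsetI => p /SS pS /=.
    have := h (exist _ p pS); rewrite /goe_std /=.
    by rewrite -[p in B' p]/(val (exist _ p pS : upper n)) B'val.
  move=> /in_bigsetI h i; have := h (val i); rewrite inE (valP i) => /(_ isT).
  by rewrite /= B'val.
rewrite indG //.
have -> : S = [set val i | i in [set: upper n]]%SET.
  apply/setP => p; rewrite inE; apply/idP/imsetP => [h|[i _ ->]].
    by exists (exist _ p h).
  exact: (valP i).
rewrite big_imset /=; last by move=> i j _ _; exact: val_inj.
apply: eq_big => [i|i _]; first by rewrite inE.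
rewrite (normG _ _ _ (valP i) (mB' _)) B'val normal_prob_scale //; exact: goe_sd_gt0.
Qed.

(** The boolean tells a strictly lower position from its transpose, which makes the coding
    injective: each of the n^2 positions gets its own variable among two copies of the upper
    triangle. *)
Lemma upper_code : exists f : 'I_n * 'I_n -> bool * upper n, forall p,
  (f p).1 = (p.1 <= p.2)%N /\
  val (f p).2 = if (p.1 <= p.2)%N then p else (p.2, p.1).
Proof.
have H (p : 'I_n * 'I_n) : exists q : bool * upper n,
    q.1 = (p.1 <= p.2)%N /\ val q.2 = if (p.1 <= p.2)%N then p else (p.2, p.1).
  have [h|/ltnW h] := leqP p.1 p.2; first by exists (true, exist _ p h).
  by exists (false, exist (fun q : 'I_n * 'I_n => q.1 <= q.2)%N (p.2, p.1) h).
by have [f hf] := choice H; exists f.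
Qed.

(* The antisymmetric part is filled with an independent copy of G. *)
Lemma goe_sym_iid : exists Y : T * T -> 'M[R]_n,
  iid_normal_mx (P \x P)%E Y /\ forall w, sym_mx (Y w) = GOE_mx G w.1.
Proof.
have [mG symG normG indG] := GG.
have [f fP] := upper_code.
have finj : injective f.
  move=> p q fpq; have [p1 p2] := fP p; have [q1 q2] := fP q.
  move: p1 p2; rewrite fpq q1 q2 => <-; case: ifP => // _.
  by case: p q {fpq q1 q2} => [a b] [a' b'] [-> ->].
(* A rotation by 45 degrees in each pair of transposed positions sends (g, g') to ((g - g') / sqrt
   2, (g + g') / sqrt 2), whose sum divided by sqrt 2 is g. *)
pose s2 : R := (Num.sqrt 2)^-1.
have s2n : s2 != 0 by rewrite invr_eq0 gt_eqF // sqrtr_gt0.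
have s2s : s2 ^+ 2 + s2 ^+ 2 = 1.
  by rewrite /s2 exprVn sqr_sqrtr //; field.
pose sg (p : 'I_n * 'I_n) := (p.2, p.1).
have sgK : involutive sg by case.
have Asg (p : 'I_n * 'I_n) : (p.1 < p.2)%N -> ~~ ((sg p).1 < (sg p).2)%N.
  by rewrite -leqNgt => /ltnW.
have iW := iid_normal_reindex finj (iid_normal_copy goe_std_iid).
have iY := iid_normal_rotate (A := fun p : 'I_n * 'I_n => (p.1 < p.2)%N) sgK Asg s2n s2s iW.
set Z := (X in iid_normal _ X) in iY.
pose Y w : 'M[R]_n := \matrix_(i, j) Z (i, j) w.
exists Y; split=> [|w].
  move: iY; congr iid_normal.
  by apply/funext => -[i j]; apply/funext => w; rewrite /Y mxE.
apply/matrixP => i j; rewrite !mxE /Z /sg /=.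
have ss : s2 * (s2 + s2) = 1 by rewrite mulrDr -expr2.
have fE (k l : 'I_n) : (k < l)%N ->
    (let bi := f (k, l) in if bi.1 then goe_std bi.2 w.1 else goe_std bi.2 w.2) =
    G k l w.1.
  move=> kl; have [f1 f2] := fP (k, l); rewrite /= f1 /= ltnW //.
  rewrite /goe_std f2 /= ltnW //= /goe_sd; case: eqP => [e|_].
    by move: kl; rewrite e ltnn.
  by rewrite divr1.
have [ij|ji|ij] := ltngtP i j.
- move: (fE _ _ ij) => /= ->; rewrite -/s2.
  transitivity (s2 * (s2 + s2) * G i j w.1); first by rewrite /sg /=; ring.
  by rewrite ss mul1r.
- move: (fE _ _ ji) => /= ->; rewrite -/s2 symG.
  transitivity (s2 * (s2 + s2) * G i j w.1); first by rewrite /sg /=; ring.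
  by rewrite ss mul1r.
have {}ij : i = j by exact: val_inj.
subst j; have [f1 f2] := fP (i, i); rewrite /= f1 /= leqnn.
rewrite /goe_std f2 /= leqnn /= /goe_sd eqxx -/s2.
transitivity (s2 * (s2 + s2) * G i i w.1); first by ring.
by rewrite ss mul1r.
Qed.

Lemma measurable_goe (S : set 'M[R]_n) : event S ->
  measurable [set w | S (GOE_mx G w)].
Proof.
have [mG _ _ _] := GG; apply => i j.
by under eq_fun do rewrite mxE; exact: mG.
Qed.

Lemma event_conj (O : 'M[R]_n) (S : set 'M[R]_n) : event S ->
  event [set A | S (O *m A *m O^T)].
Proof.
move=> eS d' T' A mA; apply: eS => i j.
under eq_fun do rewrite mxE; apply: measurable_sum => k.
apply: measurable_funM => //.
by under eq_fun do rewrite mxE; apply: measurable_sum => l; apply: measurable_funM.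
Qed.

Lemma goe_fst (S : set 'M[R]_n) : event S ->
  (P \x P)%E [set w | S (GOE_mx G w.1)] = P [set w | S (GOE_mx G w)].
Proof.
move=> eS; have -> : [set w : T * T | S (GOE_mx G w.1)] =
    [set w | S (GOE_mx G w)] `*` setT.
  by apply/seteqP; split => -[w1 w2] //= [].
transitivity (P [set w | S (GOE_mx G w)] * P setT)%E.
  by apply: product_measure1E => //; exact: measurable_goe.
by rewrite probability_setT mule1.
Qed.

Lemma goe_conj (S : set 'M[R]_n) (a b : 'I_n) (c s : R) : event S ->
  a != b -> s != 0 -> c ^+ 2 + s ^+ 2 = 1 ->
  P [set w | S (givens a b c s *m GOE_mx G w *m (givens a b c s)^T)] =
  P [set w | S (GOE_mx G w)].
Proof.
move=> eS ab s0 cs; have [Y [iY YG]] := goe_sym_iid.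
have iY' := iid_normal_mx_conj ab s0 cs iY.
rewrite -(goe_fst eS) -(goe_fst (event_conj (givens a b c s) eS)).
have := iid_normal_mx_law eS iY iY'.
under eq_set do rewrite YG.
by under [in X in _ = X -> _]eq_set do rewrite sym_mx_conj YG.
Qed.
End goe_law.

(** * Simplicity of the spectrum *)

(** Stated over commutative rings so that it also applies to matrices of polynomials: the
    determinant along a line of matrices is then visibly a polynomial in the parameter. *)
Definition krylov_iter {K : comNzRingType} {n : nat} (A : 'M[K]_n) (j : nat) : 'cV[K]_n :=
  iter j (mulmx A) (const_mx 1).

Definition krylov {K : comNzRingType} {n : nat} (A : 'M[K]_n) : 'M[K]_n :=
  \matrix_(i, j) krylov_iter A j i 0.

Section krylov_algebra.
Context {n : nat}.

Lemma map_krylov (K L : comNzRingType) (f : {rmorphism K -> L}) (A : 'M[K]_n) :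
  map_mx f (krylov A) = krylov (map_mx f A).
Proof.
apply/matrixP => i j; rewrite !mxE.
have -> : krylov_iter (map_mx f A) j = map_mx f (krylov_iter A j).
  elim: (j : nat) => [|k IH]; last by rewrite /krylov_iter /= -!/(krylov_iter _ k) IH map_mxM.
  by rewrite /krylov_iter /= map_const_mx rmorph1.
by rewrite mxE.
Qed.

Lemma det_krylov_scale (K : comNzRingType) (c : K) (A : 'M[K]_n) :
  \det (krylov (c *: A)) = \det (krylov A) * \prod_(j < n) c ^+ j.
Proof.
have -> : krylov (c *: A) = krylov A *m diag_mx (\row_j c ^+ j).
  apply/matrixP => i j; rewrite mul_mx_diag !mxE.
  have -> : krylov_iter (c *: A) j = c ^+ j *: krylov_iter A j.
    elim: (j : nat) => [|k IH]; first by rewrite expr0 scale1r.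
    rewrite /krylov_iter /= -!/(krylov_iter _ k) IH -scalemxAl -scalemxAr scalerA.
    by rewrite exprS.
  by rewrite mxE mulrC.
by rewrite det_mulmx det_diag; congr (_ * _); apply: eq_bigr => i _; rewrite mxE.
Qed.

Variable R : realType.

Lemma krylov_line (A B : 'M[R]_n) : exists p : {poly R}, forall t,
  p.[t] = \det (krylov (A - t *: B)).
Proof.
exists (\det (krylov (map_mx polyC A - 'X *: map_mx polyC B))) => t.
rewrite -[LHS]/(horner_eval t _) -det_map_mx map_krylov; congr (\det (krylov _)).
apply/matrixP => i j; by rewrite !mxE /= /horner_eval !hornerE.
Qed.

Lemma poly_frequently_root (r : nat -> R) (p : {poly R}) : injective r ->
  (forall m, exists2 k, (m <= k)%N & p.[r k] = 0) -> p = 0.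
Proof.
move=> rinj H; apply/eqP; apply: contraT => pn0.
have [g hg] : exists g : nat -> nat, forall m, (m <= g m)%N /\ p.[r (g m)] = 0.
  have H' m : exists k, (m <= k)%N /\ p.[r k] = 0.
    by have [k mk pk] := H m; exists k.
  by have [g hg] := choice H'; exists g.
pose u := fix u i := if i is j.+1 then g (u j).+1 else g 0%N.
have u_incr i : (u i < u i.+1)%N by have [] := hg (u i).+1.
have u_root i : p.[r (u i)] = 0 by case: i => [|i]; exact: (hg _).2.
have u_lt i j : (i < j)%N -> (u i < u j)%N.
  exact: (homo_ltn (f := u) (r := fun a b => (a < b)%N) (fun y x z => @ltn_trans y x z) u_incr).
have uinj : injective u.
  move=> i j uij; have [/u_lt|/u_lt|//] := ltngtP i j; by rewrite uij ltnn.
have := max_poly_roots (rs := [seq r (u i) | i <- iota 0 (size p)]) pn0.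
rewrite size_map size_iota ltnn; apply.
  by apply/allP => _ /mapP[i _ ->]; rewrite /root u_root.
by rewrite map_inj_uniq ?iota_uniq // => i j /rinj/uinj.
Qed.

(** Along A - t B the polynomial vanishes, and t = 0 gives A. For B, homogeneity allows division by
    -t: B - t^-1 A has roots at infinitely many inverses of integers, so its polynomial vanishes
    too, and its value at 0 concerns B. *)
Lemma krylov_frequently (A B : 'M[R]_n) :
  (forall m, exists2 l, (m <= l)%N & \det (krylov (A - l.+1%:R *: B)) = 0) ->
  \det (krylov A) = 0 /\ \det (krylov B) = 0.
Proof.
move=> H; split.
  have [p hp] := krylov_line A B.
  have p0 : p = 0.
    apply: (@poly_frequently_root (fun l => l.+1%:R)).
      by move=> i j /eqP; rewrite eqr_nat => /eqP[].
    by move=> m; have [l ml hl] := H m; exists l => //; rewrite hp.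
  by have := hp 0; rewrite p0 horner0 scale0r subr0.
have [p hp] := krylov_line B A.
have p0 : p = 0.
  apply: (@poly_frequently_root (fun l => l.+1%:R^-1)).
    by move=> i j /invr_inj /eqP; rewrite eqr_nat => /eqP[].
  move=> m; have [l ml hl] := H m; exists l => //; rewrite hp.
  have -> : B - l.+1%:R^-1 *: A = (- l.+1%:R^-1) *: (A - l.+1%:R *: B).
    rewrite scalerBr scalerA mulNr mulVf ?pnatr_eq0 // scaleN1r opprK addrC.
    by rewrite scaleNr.
  by rewrite det_krylov_scale hl mul0r.
by have := hp 0; rewrite p0 horner0 scale0r subr0.
Qed.

Lemma regular_krylov (I : Type) (A : (I -> R) -> 'M[R]_n) :
  (forall i j, regular (fun x => A x i j)) ->
  regular (fun x => \det (krylov (A x))).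
Proof.
move=> rA; apply: regular_det => i j; under eq_fun do rewrite mxE.
suff rk k : forall (i : 'I_n) (l : 'I_1), regular (fun x => krylov_iter (A x) k i l) by exact: rk.
elim: k => [|k IH] {}i l; last exact: regular_mulmx.
by under eq_fun do rewrite mxE; exact: regular_cst.
Qed.

Lemma event_krylov : event [set A : 'M[R]_n | \det (krylov A) = 0].
Proof.
move=> d T A mA.
have rk : regular (fun x : 'I_n * 'I_n -> R => \det (krylov (\matrix_(i, j) x (i, j)))).
  apply: regular_krylov => i j; under eq_fun do rewrite mxE; exact: regular_coord.
have mk := measurable_regular (X := fun p w => A w p.1 p.2) (fun p => mA _ _) rk.
rewrite (_ : [set w | _] = (fun w : T => \det (krylov
   (\matrix_(i, j) (fun p => A w p.1 p.2) (i, j)))) @^-1` [set 0]).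
  exact: measurable_preimage.
apply/seteqP; split => w /=.
  move=> <-; congr (\det (krylov _)); by apply/matrixP => i j; rewrite mxE.
move=> <-; congr (\det (krylov _)); by apply/matrixP => i j; rewrite mxE.
Qed.

(** The Krylov matrix of a diagonal matrix is the transposed Vandermonde matrix of its entries,
    which are distinct here. *)
Lemma det_krylov_diag :
  \det (krylov (diag_mx (\row_(j < n) j%:R) : 'M[R]_n)) != 0.
Proof.
pose a : 'rV[R]_n := \row_(j < n) j%:R.
have -> : krylov (diag_mx a) = (Vandermonde n a)^T.
  apply/matrixP => i j; rewrite !mxE.
  have E k : krylov_iter (diag_mx a) k = \col_i a 0 i ^+ k.
    elim: k => [|k IH]; first by apply/matrixP => u v; rewrite !mxE expr0.
    rewrite /krylov_iter /= -/(krylov_iter _ k) IH mul_diag_mx.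
    by apply/matrixP => u v; rewrite !mxE exprS.
  by rewrite E !mxE.
rewrite det_tr det_Vandermonde; apply/prodf_neq0 => i _; apply/prodf_neq0 => j ij.
by rewrite !mxE subr_eq0 eqr_nat gtn_eqF.
Qed.

End krylov_algebra.

Lemma normal_prob_ball_gt0 {R : realType} (a e : R) : 0 < e ->
  (0 < normal_prob (0 : R) 1 [set x : R | (`|x - a| < e)%R])%E.
Proof.
move=> e0.
have ballE : [set x : R | (`|x - a| < e)%R] = `]a - e, a + e[%classic.
  by apply/seteqP; split => x /=; rewrite in_itv /= ltr_distl.
set B := [set x : R | _].
have mB : measurable B by rewrite /B ballE; exact: measurable_itv.
pose m : R := normal_peak 1 * expR (- (`|a| + e) ^+ 2).
have m0 : 0 < m by rewrite mulr_gt0 ?expR_gt0 // normal_peak_gt0 ?oner_neq0.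
apply: (@lt_le_trans _ _ (\int[lebesgue_measure]_(x in B) (cst m%:E) x)%E).
  have muB : lebesgue_measure B = (a + e - (a - e))%:E.
    rewrite /B ballE lebesgue_measure_itv /= lte_fin ltrD2l gtrN //.
  rewrite integral_cst //; apply: mule_gt0; first by rewrite lte_fin.
  suff : (0 < lebesgue_measure B)%E by [].
  by rewrite muB lte_fin; lra.
apply: ge0_le_integral => //=.
- by move=> x _; rewrite lee_fin ltW.
- by apply: measurable_funTS; apply/measurable_EFinP; exact: measurable_normal_pdf.
move=> x xB; rewrite lee_fin normal_pdfE ?oner_neq0 // /normal_fun subr0 expr1n.
rewrite ler_wpM2l ?normal_peak_ge0 // ler_expR mulNr lerN2.
have xae : `|x| <= `|a| + e.
  rewrite -[x in `|x|](subrK a) addrC (le_trans (ler_normD _ _)) // lerD2l ltW //.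
apply: (@le_trans _ _ (x ^+ 2)).
  by rewrite ler_pdivrMr // ler_peMr ?sqr_ge0 // ler1n.
by rewrite -(real_normK (num_real x)) lerXn2r // nnegrE addr_ge0 // ltW.
Qed.

(** * A zero-one argument for the Krylov determinant *)

Section zero_one.
Context {R : realType} {n : nat} {d : measure_display} {T : measurableType d}.
Variables (P : probability T R) (G : 'I_n -> 'I_n -> T -> R).
Hypothesis GG : is_GOE P G.

Definition upper_mx (up : 'I_n * 'I_n -> upper n) (x : upper n -> R) : 'M[R]_n :=
  \matrix_(i, j) (goe_sd i j * x (up (i, j))).

Lemma upper_mx_goe : exists up : 'I_n * 'I_n -> upper n,
  (forall p, val (up p) = if (p.1 <= p.2)%N then p else (p.2, p.1)) /\
  forall w, GOE_mx G w = upper_mx up (fun i => goe_std G i w).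
Proof.
have [mG symG normG indG] := GG.
have [f fP] := @upper_code n.
exists (fun p => (f p).2); split=> [p|w]; first exact: (fP p).2.
apply/matrixP => i j; rewrite !mxE /goe_std (fP (i, j)).2 /=.
have sdn (k l : 'I_n) : goe_sd k l != 0 :> R by rewrite gt_eqF // goe_sd_gt0.
case: ifP => _ /=; first by rewrite mulrC divfK.
have -> : goe_sd i j = goe_sd j i :> R by rewrite /goe_sd eq_sym.
by rewrite mulrC divfK.
Qed.

Lemma event_measurable_box (S : set 'M[R]_n) (up : 'I_n * 'I_n -> upper n) :
  event S ->
  measurable [set x : box_measurable R (upper n) | S (upper_mx up x)].
Proof.
move=> eS; apply: eS => i j.
have -> : (fun w : box_measurable R (upper n) => upper_mx up w i j) =
    (fun w => goe_sd i j * w (up (i, j))).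
  by apply/funext => w; rewrite mxE.
by apply: measurable_funM => //; exact: measurable_box_coord.
Qed.

Lemma goe_rotate (S : set 'M[R]_n) (c s : R) : event S ->
  s != 0 -> c ^+ 2 + s ^+ 2 = 1 ->
  (P \x P)%E [set w | S (c *: GOE_mx G w.1 - s *: GOE_mx G w.2)] =
  P [set w | S (GOE_mx G w)].
Proof.
move=> eS s0 cs; have [up [_ GE]] := upper_mx_goe.
have iX := goe_std_iid GG.
pose sg (p : bool * upper n) := (~~ p.1, p.2).
have sgK : involutive sg by move=> [b i]; rewrite /sg /= negbK.
have Asg (p : bool * upper n) : p.1 -> ~~ (sg p).1 by rewrite negbK.
have iZ := iid_normal_rotate (A := fun p : bool * upper n => p.1) sgK Asg s0 cs
  (iid_normal_copy iX).
have tinj : injective (fun i : upper n => (true, i)) by move=> i j [].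
have {}iZ := iid_normal_reindex tinj iZ.
have /= := iid_normal_law iX iZ (event_measurable_box up eS).
under eq_set do rewrite -GE.
move=> ->; congr ((P \x P)%E _).
apply/seteqP; split => w /=; rewrite !GE;
  (have -> : upper_mx up (fun i => c * goe_std G i w.1 - s * goe_std G i w.2) =
    c *: upper_mx up (fun i => goe_std G i w.1) -
    s *: upper_mx up (fun i => goe_std G i w.2) by
    apply/matrixP => i j; rewrite !mxE; ring); by [].
Qed.

Lemma goe_krylov_lt1 : (P [set w | (\det (krylov (GOE_mx G w)) = 0)%R] < 1)%E.
Proof.
have [up [upE GE]] := upper_mx_goe.
have [mX PX] := goe_std_iid GG.
pose D : 'M[R]_n := diag_mx (\row_(j < n) j%:R).
pose x0 (u : upper n) : R := D (val u).1 (val u).2 / goe_sd (val u).1 (val u).2.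
have x0E : upper_mx up x0 = D.
  apply/matrixP => i j; rewrite mxE /x0 upE /=.
  have sdn (k l : 'I_n) : goe_sd k l != 0 :> R by rewrite gt_eqF // goe_sd_gt0.
  case: ifP => _ /=; first by rewrite mulrC divfK.
  have -> : goe_sd i j = goe_sd j i :> R by rewrite /goe_sd eq_sym.
  rewrite mulrC divfK // !mxE eq_sym; case: eqP => [->//|_].
  by rewrite !mulr0n.
have rf : regular (fun x => \det (krylov (upper_mx up x))).
  apply: regular_krylov => i j; under eq_fun do rewrite mxE.
  by apply: regular_mul; [exact: regular_cst|exact: regular_coord].
have [|e e0 He] := regular_neq0_ball (V := x0) rf.
  by rewrite x0E det_krylov_diag.
pose B (u : upper n) := [set x : R | (`|x - x0 u| < e)%R].
have mB u : measurable (B u).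
  have -> : B u = `]x0 u - e, x0 u + e[%classic.
    by apply/seteqP; split => x /=; rewrite in_itv /B /= ltr_distl.
  exact: measurable_itv.
set N := [set w | _]; pose E := [set w | forall u, B u (goe_std G u w)].
have mN : measurable N by exact: (measurable_goe GG (@event_krylov n R)).
have mE : measurable E.
  by apply: measurable_forall_fin => u; exact: measurable_preimage.
have PE : (0 < P E)%E.
  rewrite /E PX //; elim/big_ind: _ => //; first exact: mule_gt0.
  by move=> u _; exact: normal_prob_ball_gt0.
have NE : N `<=` ~` E.
  move=> w /= Nw Ew; have := He _ Ew.
  by rewrite -GE Nw eqxx.
apply: (@le_lt_trans _ _ (P (~` E))).
  by apply: le_measure; rewrite ?inE //; exact: measurableC.
rewrite probability_setC //.
have [r rE] : exists r : R, P E = r%:E.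
  by exists (fine (P E)); rewrite fineK // fin_num_measure.
by move: PE; rewrite rE -EFinB !lte_fin => r0; rewrite ltrBlDr ltrDl.
Qed.

Lemma goe_krylov0 : P [set w | (\det (krylov (GOE_mx G w)) = 0)%R] = 0%E.
Proof.
have eS := @event_krylov n R.
set S := [set A | _] in eS; set N := [set w | _].
have mN : measurable N by exact: (measurable_goe GG eS).
have [q PN] : exists q : R, P N = q%:E.
  by exists (fine (P N)); rewrite fineK // fin_num_measure.
have q0 : 0 <= q by rewrite -lee_fin -PN.
have q1 : q < 1 by have := goe_krylov_lt1; rewrite -/N PN lte_fin.
pose P2 : probability (T * T)%type R := (P \x P)%E.
pose E (l : nat) := [set w : T * T | S (GOE_mx G w.1 - l.+1%:R *: GOE_mx G w.2)].
have mGE i j : measurable_fun setT (fun w => GOE_mx G w i j).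
  by have [mG _ _ _] := GG; under eq_fun do rewrite mxE; exact: mG.
have mE l : measurable (E l).
  apply: eS => i j; rewrite /=.
  rewrite (_ : (fun w => _) = (fun w : T * T => GOE_mx G w.1 i j - l.+1%:R * GOE_mx G w.2 i j)).
    apply: measurable_funB; first exact: (measurableT_comp (mGE i j)).
    by apply: measurable_funM => //; exact: (measurableT_comp (mGE i j)).
  by apply/funext => w; rewrite !mxE.
have PE l : P2 (E l) = q%:E.
  set t : R := l.+1%:R.
  have t1 : 0 < 1 + t ^+ 2 by rewrite ltr_pwDl // sqr_ge0.
  (* The factor that makes c (G - t G') a GOE matrix again; by homogeneity of the determinant it
     does not change the zero set. *)
  pose c : R := (Num.sqrt (1 + t ^+ 2))^-1.
  have c0 : c != 0 by rewrite invr_eq0 gt_eqF // sqrtr_gt0.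
  have cs : c ^+ 2 + (c * t) ^+ 2 = 1.
    rewrite exprMn /c exprVn sqr_sqrtr ?ltW //.
    by rewrite -[X in X + _]mulr1 -mulrDr mulVf // gt_eqF.
  have ct0 : c * t != 0 by rewrite mulf_neq0 // pnatr_eq0.
  transitivity (P2 [set w | S (c *: GOE_mx G w.1 - (c * t) *: GOE_mx G w.2)]); last first.
    by rewrite -PN; exact: (goe_rotate eS ct0 cs).
  have SE (A A' : 'M[R]_n) : S (c *: A - (c * t) *: A') <-> S (A - t *: A').
    have -> : c *: A - (c * t) *: A' = c *: (A - t *: A').
      by rewrite scalerBr scalerA.
    rewrite /S /= det_krylov_scale; split=> [/eqP|->]; last by rewrite mul0r.
    rewrite mulf_eq0 => /orP[/eqP //|].
    by rewrite prodf_seq_eq0 => /hasP[j _]; rewrite expf_eq0 (negbTE c0) andbF.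
  have -> : E l = [set w | S (c *: GOE_mx G w.1 - (c * t) *: GOE_mx G w.2)].
    by apply/seteqP; split => w /SE.
  by [].
pose B := N `*` N.
have mB : measurable B by exact: measurableX.
have PB : P2 B = (q * q)%:E.
  by rewrite EFinM -PN; exact: product_measure1E.
(* A point in infinitely many [E l] belongs to [B], so these sets decrease to the empty set and
   their probability tends to 0. As [E m] is covered by [B] and [F m], the limit gives q <= q^2. *)
pose F m := \bigcup_(l in [set l | (m <= l)%N]) (E l `\` B).
have mF m : measurable (F m).
  by apply: bigcup_measurable => l _; exact: measurableD.
have F0 : \bigcap_m F m = set0.
  apply/seteqP; split => // w Fw.
  have [_ _ [_ nB]] := Fw 0%N I; apply: nB.
  have [|A1 A2] := @krylov_frequently n R (GOE_mx G w.1) (GOE_mx G w.2); last by split.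
  by move=> m; have [l ml [El _]] := Fw m I; exists l.
have cF : (P2 \o F) m @[m --> \oo] --> P2 (\bigcap_m F m).
  apply: nonincreasing_cvg_mu => //.
  - by apply: (@le_lt_trans _ _ 1%E); [exact: probability_le1|rewrite ltry].
  - exact: bigcapT_measurable.
  - move=> a b ab; apply/subsetPset; apply: bigcup_subset => l /=.
    exact: leq_trans.
move: cF; rewrite F0 measure0 => /fine_cvgP[_ cF].
have qle m : q <= q * q + fine (P2 (F m)).
  rewrite -lee_fin EFinD fineK; last by rewrite fin_num_measure.
  rewrite -PB -(PE m); apply: le_trans (measureU2 P2 mB (mF m)).
  apply: le_measure; rewrite ?inE //; first exact: measurableU.
  move=> w Ew; have [Bw|nBw] := pselect (B w); first by left.
  by right; exists m => /=.
have qq : q <= q * q.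
  apply/ler_addgt0Pr => e e0.
  move/cvgrPdist_lt : cF => /(_ e e0) [m _ /(_ m (leqnn m))] /=.
  rewrite sub0r normrN => hm; apply: le_trans (qle m) _.
  by rewrite lerD2l (le_trans (ler_norm _)) // ltW.
rewrite PN; congr EFin; apply/eqP; rewrite eq_le q0 andbT.
have : 0 <= q * (q - 1) by rewrite mulrBr mulr1 subr_ge0.
by rewrite leNgt; apply: contraTT; rewrite -ltNge => qp; rewrite negbK pmulr_rlt0 // subr_lt0.
Qed.
End zero_one.

(** * Spectral decompositions *)

Section spectral.
Context {R : realType} {n : nat}.
Implicit Types (A V : 'M[R]_n) (lam : 'I_n -> R).

Definition spec_mx V (a : 'I_n -> R) : 'M[R]_n :=
  V *m diag_mx (\row_i a i) *m V^T.

Lemma spec_mxE V a i j : spec_mx V a i j = \sum_k a k * (V i k * V j k).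
Proof.
rewrite /spec_mx mul_mx_diag mxE; apply: eq_bigr => k _.
by rewrite !mxE; ring.
Qed.

Lemma sum_colproj V (a : 'I_n -> R) : \sum_i a i *: colproj V i = spec_mx V a.
Proof.
apply/matrixP => i j; rewrite spec_mxE summxE; apply: eq_bigr => k _.
by rewrite !mxE big_ord1 !mxE.
Qed.

Lemma orthogonal_tr V : V^T *m V = 1%:M -> V *m V^T = 1%:M.
Proof. exact: mulmx1C. Qed.

Lemma spec_mx_diag V a : V^T *m V = 1%:M ->
  V^T *m spec_mx V a *m V = diag_mx (\row_i a i).
Proof. by move=> VV; rewrite /spec_mx !mulmxA VV mul1mx -mulmxA VV mulmx1. Qed.

Lemma spec_mx_conj (O V : 'M[R]_n) a :
  spec_mx (O *m V) a = O *m spec_mx V a *m O^T.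
Proof. by rewrite /spec_mx trmx_mul !mulmxA. Qed.

Lemma spectral_decompP A lam V : spectral_decomp A lam V <->
  [/\ V^T *m V = 1%:M, (forall i j : 'I_n, (i <= j)%N -> lam j <= lam i) &
      A = spec_mx V lam].
Proof. by rewrite /spectral_decomp sum_colproj. Qed.

Lemma spectral_decomp_conj (O A V : 'M[R]_n) lam : O^T *m O = 1%:M ->
  spectral_decomp A lam V -> spectral_decomp (O *m A *m O^T) lam (O *m V).
Proof.
move=> OO /spectral_decompP[VV srt AE]; apply/spectral_decompP; split=> //.
  by rewrite trmx_mul mulmxA -(mulmxA _ _ O) OO mulmx1.
by rewrite AE spec_mx_conj.
Qed.

Definition half_mx V : 'M[R]_n := spec_mx V half_sign.

Lemma ZmatE A lam V : spectral_decomp A lam V ->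
  Zmat lam V = ((3 * pi / 8) * Num.sqrt n%:R) *: half_mx V - A.
Proof.
move=> /spectral_decompP[_ _ ->]; rewrite /Zmat sum_colproj.
apply/matrixP => i j; rewrite spec_mxE [RHS]mxE [X in _ = X + _]mxE.
rewrite [X in _ = _ + X]mxE !spec_mxE mulr_sumr -sumrB.
by apply: eq_bigr => k _; rewrite mulrBl; congr (_ - _); ring.
Qed.

Definition quad (u : 'cV[R]_n) A : R := (u^T *m A *m u) 0 0.

(* The event of the theorem is al = (3 pi / 8) sqrt n, be = 1, u = e_k; for be = 0
   the event is covariant under conjugation by orthogonal matrices. *)
Definition tail_event (al be t : R) (u : 'cV[R]_n) (k : 'I_n) : set 'M[R]_n :=
  [set A | exists lam V, spectral_decomp A lam V /\
     t <= `|al * quad u (half_mx V) - be * A k k|].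

Section measurability.
Variables (al be t : R) (u : 'cV[R]_n) (k : 'I_n).

Let I := ('I_n * 'I_n)%type.
Let Am (x : I + I -> R) : 'M[R]_n := \matrix_(i, j) x (inl (i, j)).
Let Vm (x : I + I -> R) : 'M[R]_n := \matrix_(i, j) x (inr (i, j)).
Let Dm x : 'M[R]_n := (Vm x)^T *m Am x *m Vm x.
Let Phi x : R := al * quad u (half_mx (Vm x)) - be * Am x k k.

(* Vanishes exactly when Vm x diagonalises Am x with sorted eigenvalues and
   large statistic; [y + `|y|] is twice the positive part of y. *)
Let defect (x : I + I -> R) : R :=
  \sum_(p : I) `|((Vm x)^T *m Vm x) p.1 p.2 - (p.1 == p.2)%:R| +
  \sum_(p : I | p.1 != p.2) `|Dm x p.1 p.2| +
  \sum_(p : I | (p.1 <= p.2)%N)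
     (Dm x p.2 p.2 - Dm x p.1 p.1 + `|Dm x p.2 p.2 - Dm x p.1 p.1|) +
  (t - `|Phi x| + `|t - `|Phi x| |).

Let pos_ge0 (y : R) : 0 <= y + `|y|.
Proof. by rewrite -lerBlDl sub0r -normrN ler_norm. Qed.

Let pos_eq0 (y : R) : (y + `|y| == 0) = (y <= 0).
Proof.
by rewrite addrC addr_eq0; apply/eqP/idP => [h|/ler0_norm//]; rewrite -oppr_ge0 -h.
Qed.

Let defect_ge0 x : 0 <= defect x.
Proof.
apply: addr_ge0; last exact: pos_ge0.
apply: addr_ge0; last by apply: sumr_ge0 => p _; exact: pos_ge0.
by apply: addr_ge0; exact: sumr_ge0.
Qed.

Let regular_defect : regular defect.
Proof.
have rA i j : regular (fun x => Am x i j).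
  by under eq_fun do rewrite mxE; exact: regular_coord.
have rV i j : regular (fun x => Vm x i j).
  by under eq_fun do rewrite mxE; exact: regular_coord.
have rVt i j : regular (fun x => (Vm x)^T i j).
  by under eq_fun do rewrite mxE; exact: rV.
have rD i j : regular (fun x => Dm x i j).
  by apply: regular_mulmx => // {}i {}j; exact: regular_mulmx.
have rpos f : regular f -> regular (fun x => f x + `|f x|).
  by move=> rf; apply: regular_add => //; exact: regular_norm.
have rDD i j : regular (fun x => Dm x i i - Dm x j j) by exact: regular_sub.
have rPhi : regular Phi.
  apply: regular_sub; apply: regular_mul => //; first exact: regular_cst.
    have cst m1 m2 (B : 'M[R]_(m1, m2)) i j : regular (fun _ : I + I -> R => B i j).
      exact: regular_cst.
    apply: regular_mulmx => [i j|//]; apply: regular_mulmx => [//|{}i {}j].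
    apply: regular_mulmx => [{}i {}j|//]; exact: regular_mulmx.
  exact: regular_cst.
apply: regular_add; last first.
  apply: rpos; apply: regular_sub; first exact: regular_cst.
  exact: regular_norm.
apply: regular_add; last by apply: regular_sum => p; exact: rpos.
apply: regular_add; last by apply: regular_sum => p; exact: regular_norm.
apply: regular_sum => p; apply: regular_norm; apply: regular_sub.
  exact: regular_mulmx.
exact: regular_cst.
Qed.

Let join (A V : 'M[R]_n) (s : I + I) : R :=
  match s with inl p => A p.1 p.2 | inr p => V p.1 p.2 end.

Let AmE A V : Am (join A V) = A.
Proof. by apply/matrixP => i j; rewrite mxE. Qed.

Let VmE A V : Vm (join A V) = V.
Proof. by apply/matrixP => i j; rewrite mxE. Qed.

Let defect_eq0 A V : defect (join A V) = 0 <->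
  [/\ V^T *m V = 1%:M, (forall i j, i != j -> (V^T *m A *m V) i j = 0),
      (forall i j : 'I_n, (i <= j)%N ->
          (V^T *m A *m V) j j <= (V^T *m A *m V) i i) &
      t <= `|al * quad u (half_mx V) - be * A k k|].
Proof.
have s1 : 0 <= \sum_(p : I) `|(V^T *m V) p.1 p.2 - (p.1 == p.2)%:R| by exact: sumr_ge0.
have s2 : 0 <= \sum_(p : I | p.1 != p.2) `|(V^T *m A *m V) p.1 p.2| by exact: sumr_ge0.
set D := V^T *m A *m V in s2 *.
have s3 : 0 <= \sum_(p : I | (p.1 <= p.2)%N)
   (D p.2 p.2 - D p.1 p.1 + `|D p.2 p.2 - D p.1 p.1|).
  by apply: sumr_ge0 => p _; exact: pos_ge0.
rewrite /defect /Phi /Dm AmE VmE -/D.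
split=> [/eqP|[h1 h2 h3 h4]].
  rewrite paddr_eq0 ?pos_ge0 //; last by apply: addr_ge0 => //; exact: addr_ge0.
  rewrite paddr_eq0 //; last exact: addr_ge0.
  rewrite paddr_eq0 // pos_eq0 subr_le0.
  rewrite psumr_eq0 // psumr_eq0 // psumr_eq0; last by move=> p _; exact: pos_ge0.
  case/andP => /andP[/andP[/allP h1 /allP h2] /allP h3] h4; split=> //.
  - apply/matrixP => i j; have := h1 (i, j) (mem_index_enum _).
    by rewrite /= normr_eq0 subr_eq0 mxE => /eqP ->; rewrite mxE.
  - move=> i j ij; have := h2 (i, j) (mem_index_enum _).
    by rewrite /= ij /= normr_eq0 => /eqP.
  - move=> i j ij; have := h3 (i, j) (mem_index_enum _).
    by rewrite /= ij /= pos_eq0 subr_le0.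
rewrite big1 ?add0r; last by move=> p _; rewrite h1 mxE subrr normr0.
rewrite big1 ?add0r; last by move=> p pp; rewrite h2 // normr0.
rewrite big1 ?add0r; last first.
  by move=> p pp; apply/eqP; rewrite pos_eq0 subr_le0; exact: h3.
by apply/eqP; rewrite pos_eq0 subr_le0.
Qed.

(** The eigenvalues are eliminated as the diagonal entries of V^T A V, so that the only unknown left
    is [V], which orthogonality keeps bounded. *)
Let tail_eventP A : tail_event al be t u k A <-> exists V, defect (join A V) = 0.
Proof.
split=> [[lam [V [/spectral_decompP[VV srt AE] h]]]|[V /defect_eq0[VV off srt h]]].
  exists V; apply/defect_eq0.
  have DE : V^T *m A *m V = diag_mx (\row_i lam i) by rewrite AE spec_mx_diag.
  split=> // i j; rewrite DE !mxE ?eqxx ?mulr1n; last exact: srt.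
  by move=> /negbTE ->; rewrite mulr0n.
exists (fun i => (V^T *m A *m V) i i), V; split=> //.
apply/spectral_decompP; split=> //.
have VV' := orthogonal_tr VV.
have DE : diag_mx (\row_i (V^T *m A *m V) i i) = V^T *m A *m V.
  apply/matrixP => i j; rewrite mxE.
  have [->|ij] := eqVneq i j; first by rewrite mulr1n mxE.
  by rewrite mulr0n off.
by rewrite /spec_mx DE !mulmxA VV' mul1mx -mulmxA VV' mulmx1.
Qed.

(** Columns of [V] are unit vectors, so the zeros of [defect] lie in a bounded box and
    [bounded_zero_rational] replaces the existential over [V] by countable intersections and unions
    over rational matrices. *)
Lemma event_tail : event (tail_event al be t u k).
Proof.
move=> d T A mA.
pose Q (m : nat) (q : {ffun I -> rat}) : set T :=
  if `[< forall i, `|ratr (q i) : R| <= 2 >] then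
    [set w | defect (join (A w) (\matrix_(i, j) ratr (q (i, j)))) < m.+1%:R^-1]
  else set0.
have mQ m q : measurable (Q m q).
  rewrite /Q; case: ifP => // _.
  rewrite -[X in measurable X]setTI; apply: measurable_fun_ltr => //.
  apply: (measurable_regular (X := fun s w =>
    join (A w) (\matrix_(i, j) ratr (q (i, j))) s)) regular_defect => -[p|p] //=.
have -> : [set w | tail_event al be t u k (A w)] = \bigcap_m \bigcup_j
    (if unpickle j is Some q then Q m q else set0).
  have tailQ w : tail_event al be t u k (A w) <-> forall m, exists q, Q m q w.
    pose F (v : I -> R) := defect (join (A w) (\matrix_(i, j) v (i, j))).
    have rF : regular F.
      apply: (regular_comp (g := fun s (v : I -> R) =>
        join (A w) (\matrix_(i, j) v (i, j)) s)) regular_defect _.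
      move=> [p|p] /=; first exact: regular_cst.
      by under eq_fun do rewrite mxE; exact: regular_coord.
    have FB v : F v = 0 -> forall i, `|v i| <= 1.
      move=> /defect_eq0[VV _ _ _] [i j].
      have := congr1 (fun B : 'M[R]_n => B j j) VV; rewrite !mxE eqxx mulr1n => sum1.
      have : v (i, j) ^+ 2 <= 1.
        rewrite -sum1 (bigD1 i) //= !mxE -expr2 lerDl.
        by apply: sumr_ge0 => l _; rewrite !mxE -expr2 sqr_ge0.
      by rewrite -(real_normK (num_real (v (i, j)))) expr_le1.
    have key := bounded_zero_rational (F := F) (fun v => defect_ge0 _)
      (fun T' FF v z FFF cv => cvg_regular FFF cv rF) FB.
    transitivity (exists v, F v = 0).
      rewrite tail_eventP; split=> [[V hV]|[v hv]].
        exists (fun p => V p.1 p.2); rewrite /F; congr (_ = 0): hV.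
        by congr (defect (join _ _)); apply/matrixP => i j; rewrite mxE.
      by exists (\matrix_(i, j) v (i, j)).
    rewrite key; split=> h m; have [q] := h m.
      by move=> [q2 Fq]; exists q; rewrite /Q; case: asboolP.
    by rewrite /Q; case: asboolP => // q2 Fq; exists q.
  apply/seteqP; split => w /=.
    move=> /tailQ h m _; have [q Qq] := h m.
    by exists (pickle q) => //; rewrite pickleK.
  move=> h; apply/tailQ => m; have [j _] := h m Logic.I.
  by case: unpickle => // q Qq; exists q.
apply: bigcapT_measurable => m; apply: bigcupT_measurable => j.
by case: unpickle.
Qed.
End measurability.
End spectral.

(** * Uniqueness of the signed projector sum for simple spectrum *)

Section eigen.
Context {R : realType} {n : nat}.
Implicit Types (A V : 'M[R]_n) (lam : 'I_n -> R).

Lemma eigen_row A lam V i : spectral_decomp A lam V ->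
  (col i V)^T *m A = lam i *: (col i V)^T.
Proof.
move=> /spectral_decompP[VV _ ->].
have -> : (col i V)^T = row i V^T by apply/rowP => j; rewrite !mxE.
rewrite -row_mul /spec_mx !mulmxA VV mul1mx.
by rewrite mul_diag_mx; apply/rowP => j; rewrite !mxE.
Qed.

(** A left eigenvector satisfies w A^k 1 = a^k (w 1), which is 0 for every k. *)
Lemma krylov_orthogonal A (w : 'rV[R]_n) (a : R) : w *m A = a *: w ->
  w *m const_mx 1 = (0 : 'M[R]_1) -> w *m krylov A = 0.
Proof.
move=> wA w1; apply/rowP => j; rewrite !mxE.
have E k : w *m krylov_iter A k = (0 : 'M[R]_1).
  elim: k => [//|k IH].
  by rewrite /krylov_iter /= -/(krylov_iter _ k) mulmxA wA -scalemxAl IH scaler0.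
have := congr1 (fun B : 'M[R]_1 => B 0 0) (E j); rewrite !mxE => h.
by rewrite -[RHS]h; apply: eq_bigr => i _; rewrite mxE.
Qed.

(* A double eigenvalue leaves room for an eigenvector orthogonal to the vector
   of ones, which then annihilates the whole Krylov matrix. *)
Lemma tie_krylov0 A lam V i j : spectral_decomp A lam V -> i != j ->
  lam i = lam j -> \det (krylov A) = 0.
Proof.
move=> sd ij lij; have /spectral_decompP[VV _ _] := sd.
have VVE k l : \sum_m V m k * V m l = (k == l)%:R.
  have := congr1 (fun B : 'M[R]_n => B k l) VV; rewrite !mxE => <-.
  by apply: eq_bigr => m _; rewrite !mxE.
pose one := const_mx 1 : 'cV[R]_n.
pose v k := (col k V)^T.
have vA k : v k *m A = lam k *: v k by exact: eigen_row.
pose al := (v j *m one) 0 0; pose be := (v i *m one) 0 0.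
have nz (a b : R) : a *: v i + b *: v j = 0 -> a = 0 /\ b = 0.
  move=> h; have hm m : a * V m i + b * V m j = 0.
    by have := congr1 (fun B : 'rV[R]_n => B 0 m) h; rewrite !mxE.
  have sum0 l : a * (\sum_m V m i * V m l) + b * (\sum_m V m j * V m l) = 0.
    rewrite !mulr_sumr -big_split /= big1 // => m _.
    by rewrite !mulrA -mulrDl hm mul0r.
  have := sum0 i; have := sum0 j; rewrite !VVE !eqxx (negbTE ij) eq_sym (negbTE ij).
  by rewrite !mulr0n !mulr1n !mulr0 !mulr1 add0r addr0 => -> ->.
have inner (a b : R) : a * be + b * al = 0 ->
    (a *: v i + b *: v j) *m one = (0 : 'M[R]_1).
  move=> h; apply/matrixP => r c; rewrite !ord1 mulmxDl -!scalemxAl mxE.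
  by rewrite [X in X + _]mxE [X in _ + X]mxE h mxE.
have eig (a b : R) : (a *: v i + b *: v j) *m A = lam i *: (a *: v i + b *: v j).
  by rewrite mulmxDl -!scalemxAl !vA -lij scalerDr !scalerA ![_ * lam i]mulrC.
(* The combination al v_i - be v_j is always orthogonal to the ones, but might be zero if [be] is;
   in that case v_i itself is orthogonal to them. *)
apply/eqP/det0P; have [be0|be0] := eqVneq be 0.
  exists (1 *: v i + 0 *: v j).
    by apply/eqP => /nz[/eqP]; rewrite oner_eq0.
  by apply: (krylov_orthogonal (eig 1 0)); apply: inner; rewrite be0; ring.
exists (al *: v i + (- be) *: v j).
  by apply/eqP => /nz[_ /eqP]; rewrite oppr_eq0 (negbTE be0).
by apply: (krylov_orthogonal (eig _ _)); apply: inner; ring.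
Qed.

(** If an eigenvalue of one decomposition were missing from the other, its eigenvector would be
    orthogonal to a whole orthonormal basis. Two strictly decreasing lists with the same elements
    coincide. *)
Lemma eigen_unique A lam V lam' V' : \det (krylov A) != 0 ->
  spectral_decomp A lam V -> spectral_decomp A lam' V' -> lam =1 lam'.
Proof.
move=> dA sd sd'.
have dec l W : spectral_decomp A l W -> forall i j : 'I_n, (i < j)%N -> l j < l i.
  move=> sdl i j ij; have /spectral_decompP[_ srt _] := sdl.
  rewrite lt_neqAle (srt _ _ (ltnW ij)) andbT; apply/eqP => lji.
  have ji : j != i by apply/eqP => e; rewrite e ltnn in ij.
  by move: dA; rewrite (tie_krylov0 sdl ji lji) eqxx.
have sub l W l' W' : spectral_decomp A l W -> spectral_decomp A l' W' ->
    forall i, exists j, l i = l' j.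
  move=> h h' i; apply: contrapT => no.
  have /spectral_decompP[WW _ _] := h; have /spectral_decompP[WW' _ AE'] := h'.
  have z : (col i W)^T *m W' = 0.
    apply/rowP => j; rewrite [RHS]mxE.
    have := congr1 (fun B => (B *m W') 0 j) (eigen_row i h).
    rewrite {1}AE' /spec_mx -!mulmxA WW' mulmx1 mulmxA mul_mx_diag mxE.
    rewrite -scalemxAl [X in _ = X -> _]mxE mxE mulrC => /eqP.
    rewrite -subr_eq0 -mulrBl mulf_eq0 subr_eq0 => /orP[/eqP e|/eqP //].
    by exfalso; apply: no; exists j; move: e; rewrite mxE.
  have : (col i W)^T = 0 by rewrite -[LHS]mulmx1 -(orthogonal_tr WW') mulmxA z mul0mx.
  move/(congr1 (fun B : 'rV[R]_n => (B *m W) 0 i)).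
  have -> : (col i W)^T = row i W^T by apply/rowP => j; rewrite !mxE.
  rewrite -row_mul WW mul0mx !mxE eqxx => /eqP; by rewrite oner_eq0.
have srt l W : spectral_decomp A l W -> sorted >%R [seq l i | i <- enum 'I_n].
  move=> h; rewrite sorted_pairwise; last by move=> x y z /= xy yz; exact: lt_trans yz xy.
  rewrite pairwise_map; have := iota_ltn_sorted 0 n; rewrite -val_enum_ord.
  rewrite sorted_pairwise; last exact: ltn_trans.
  rewrite pairwise_map; apply: sub_pairwise => i j /=; exact: dec h _ _.
have : [seq lam i | i <- enum 'I_n] = [seq lam' i | i <- enum 'I_n].
  apply: (irr_sorted_eq (leT := >%R)).
  - by move=> x y z /= xy yz; exact: lt_trans yz xy.
  - by move=> x /=; rewrite ltxx.
  - exact: srt sd.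
  - exact: srt sd'.
  move=> x; apply/mapP/mapP => -[i _ ->].
    by have [j ->] := sub _ _ _ _ sd sd' i; exists j; rewrite ?mem_enum.
  by have [j ->] := sub _ _ _ _ sd' sd i; exists j; rewrite ?mem_enum.
by move/eq_in_map => h i; apply: h; rewrite mem_enum.
Qed.

(** The change of basis W = V'^T V commutes with a diagonal matrix of distinct entries, so it is
    diagonal with entries 1 or -1, and these signs cancel in V diag V^T. *)
Lemma half_mx_unique A lam V lam' V' : \det (krylov A) != 0 ->
  spectral_decomp A lam V -> spectral_decomp A lam' V' -> half_mx V = half_mx V'.
Proof.
move=> dA sd sd'; have ll := eigen_unique dA sd sd'.
have /spectral_decompP[VV _ AE] := sd; have /spectral_decompP[VV' _ AE'] := sd'.
have [W WE] : exists W, W = V'^T *m V by eexists.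
have VE : V = V' *m W by rewrite WE mulmxA (orthogonal_tr VV') mul1mx.
have WW : W *m W^T = 1%:M.
  by rewrite WE trmx_mul trmxK -mulmxA (mulmxA V) (orthogonal_tr VV) mul1mx.
have WD i j : i != j -> W i j = 0.
  move=> ij; have h : diag_mx (\row_i lam' i) *m W = W *m diag_mx (\row_i lam i).
    have h1 : V'^T *m A = diag_mx (\row_i lam' i) *m V'^T.
      by rewrite AE' /spec_mx !mulmxA VV' mul1mx.
    have h2 : A *m V = V *m diag_mx (\row_i lam i).
      by rewrite AE /spec_mx -!mulmxA VV mulmx1.
    by rewrite WE mulmxA -h1 -!mulmxA h2.
  have := congr1 (fun B : 'M[R]_n => B i j) h.
  rewrite mul_diag_mx mul_mx_diag !mxE -ll mulrC => /eqP.
  rewrite -subr_eq0 -mulrBr mulf_eq0 subr_eq0 => /orP[/eqP //|/eqP lij].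
  by move: dA; rewrite (tie_krylov0 sd ij lij) eqxx.
have W1 i : W i i * W i i = 1.
  have := congr1 (fun B : 'M[R]_n => B i i) WW; rewrite !mxE eqxx mulr1n => <-.
  rewrite (bigD1 i) //= big1 ?addr0; first by rewrite !mxE.
  by move=> k ki; rewrite !mxE WD ?mul0r // eq_sym.
rewrite /half_mx {1}VE spec_mx_conj; congr (_ *m _ *m _).
apply/matrixP => i j; rewrite spec_mxE !mxE.
rewrite (bigD1 i) //= big1 ?addr0; last first.
  by move=> k ki; rewrite (WD i k) ?mul0r ?mulr0 // eq_sym.
have [->|ij] := eqVneq i j; first by rewrite W1 mulr1 mulr1n.
by rewrite (WD j i) ?mulr0 ?mulr0n // eq_sym.
Qed.
End eigen.

(** * Reduction to sign vectors *)

Section reduction.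
Context {R : realType} {n : nat}.

Lemma quadE (u : 'cV[R]_n) (M : 'M[R]_n) :
  quad u M = \sum_i \sum_j u i 0 * u j 0 * M i j.
Proof.
rewrite /quad mxE exchange_big; apply: eq_bigr => j _ /=.
rewrite !mxE mulr_suml; apply: eq_bigr => i _; rewrite !mxE; ring.
Qed.

Lemma quad_conj (O M : 'M[R]_n) u : quad u (O *m M *m O^T) = quad (O^T *m u) M.
Proof. by rewrite /quad trmx_mul trmxK !mulmxA. Qed.

Lemma tail_event_conj (al t : R) (O A : 'M[R]_n) u k : O^T *m O = 1%:M ->
  tail_event al 0 t u k (O *m A *m O^T) <-> tail_event al 0 t (O^T *m u) k A.
Proof.
have sub (Q B : 'M[R]_n) v : Q^T *m Q = 1%:M ->
    tail_event al 0 t (Q^T *m v) k B -> tail_event al 0 t v k (Q *m B *m Q^T).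
  move=> QQ [lam [V [sd h]]]; exists lam, (Q *m V); split.
    exact: spectral_decomp_conj.
  by move: h; rewrite !mul0r !subr0 /half_mx spec_mx_conj quad_conj.
move=> OO; split=> [h|]; last exact: sub.
have OO' := orthogonal_tr OO.
have := sub O^T (O *m A *m O^T) (O^T *m u); rewrite !trmxK => /(_ OO').
rewrite mulmxA OO' mul1mx => /(_ h).
by rewrite !mulmxA OO mul1mx -mulmxA OO mulmx1.
Qed.

Context {d : measure_display} {T : measurableType d}.
Variables (P : probability T R) (G : 'I_n -> 'I_n -> T -> R).
Hypothesis GG : is_GOE P G.
Variables (al t : R) (k : 'I_n).

Let tail u := P [set w | tail_event al 0 t u k (GOE_mx G w)].

Lemma tail_givens (a b : 'I_n) (c s : R) u : a != b -> s != 0 ->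
  c ^+ 2 + s ^+ 2 = 1 -> tail ((givens a b c s)^T *m u) = tail u.
Proof.
move=> ab s0 cs; have OO := givens_orthogonal ab cs.
have := goe_conj GG (event_tail al 0 t u k) ab s0 cs; rewrite -[RHS]/(tail u) => <-.
by congr (P _); apply/seteqP; split => w /(tail_event_conj _ _ _ _ _ OO).
Qed.

(** Induction on the number of nonzero coordinates other than [k]: a rotation in the plane of [k]
    and [j] moves the weight of coordinate [j] onto [k]. What remains is e_k up to sign, and [quad]
    is even. *)
Lemma tail_unit (u : 'cV[R]_n) : (u^T *m u) 0 0 = 1 -> tail u = tail (delta_mx k 0).
Proof.
move: {2}(#|[set j | (j != k) && (u j 0 != 0)]%SET|)
  (leqnn #|[set j | (j != k) && (u j 0 != 0)]%SET|) => m.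
elim: m u => [|m IH] u.
  rewrite leqn0 cards_eq0 => /eqP u0 u1.
  have uj j : j != k -> u j 0 = 0.
    move=> jk; apply/eqP; apply: contraT => uj0.
    by have := finset.in_set0 j; rewrite -u0 inE jk uj0.
  have uE : u = u k 0 *: delta_mx k 0.
    apply/matrixP => i j; rewrite !mxE ord1 eqxx andbT.
    by have [->|ik] := eqVneq i k; rewrite ?mulr1 // mulr0 uj.
  have uk : u k 0 ^+ 2 = 1.
    by rewrite -[RHS]u1 mxE (bigD1 k) //= big1 ?addr0 ?mxE // => i ik; rewrite uj ?mulr0.
  have qE M : quad u M = quad (delta_mx k 0) M.
    have gen (a : R) v : quad (a *: v) M = a ^+ 2 * quad v M.
      rewrite !quadE mulr_sumr; apply: eq_bigr => i _.
      by rewrite mulr_sumr; apply: eq_bigr => j _; rewrite !mxE; ring.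
    by rewrite [in LHS]uE gen uk mul1r.
  congr (P _); apply/seteqP; split => w [lam [V [sd h]]]; exists lam, V; split=> //;
  by move: h; rewrite qE.
move=> cu u1; have [le|gt] := leqP #|[set j | (j != k) && (u j 0 != 0)]%SET| m.
  exact: IH.
have [j /andP[jk uj]] : exists j, (j != k) && (u j 0 != 0).
  have /card_gt0P[j] := leq_ltn_trans (leq0n m) gt.
  by rewrite inE => h; exists j.
pose r := Num.sqrt (u k 0 ^+ 2 + u j 0 ^+ 2).
have r2 : 0 < u k 0 ^+ 2 + u j 0 ^+ 2.
  by rewrite ltr_wpDl ?sqr_ge0 // exprn_even_gt0.
have r0 : r != 0 by rewrite gt_eqF // sqrtr_gt0.
have rr : r ^+ 2 = u k 0 ^+ 2 + u j 0 ^+ 2 by rewrite sqr_sqrtr // ltW.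
pose c := u k 0 / r; pose s := u j 0 / r.
have s0 : s != 0 by rewrite mulf_neq0 // invr_eq0.
have cs : c ^+ 2 + s ^+ 2 = 1 by rewrite /c /s !expr_div_n -mulrDl -rr divff // expf_neq0.
have kj : k != j by rewrite eq_sym.
rewrite -(tail_givens u kj s0 cs); apply: IH; last first.
  rewrite trmx_mul trmxK mulmxA -(mulmxA u^T).
  by rewrite (orthogonal_tr (givens_orthogonal kj cs)) mulmx1.
set u' := _ *m u.
have u'E i : u' i 0 = if i == k then r else if i == j then 0 else u i 0.
  rewrite /u' givens_trmx // givens_mulE /givens_act; case: ifP => _.
    rewrite /c /s; apply: (mulIf r0); rewrite -expr2 rr; field => //.
  case: ifP => _ //; rewrite /c /s; field => //.
rewrite -ltnS; apply: leq_trans cu; apply: proper_card; apply/properP; split.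
  apply/fintype.subsetP => i; rewrite !inE u'E => /andP[ik]; rewrite ik (negbTE ik) /=.
  by case: ifP => //; rewrite eqxx.
by exists j; rewrite !inE jk // u'E (negbTE jk) !eqxx.
Qed.

End reduction.

Section half_mx_facts.
Context {R : realType} {n : nat}.

Lemma half_sign_sqr (i : 'I_n) : half_sign i * half_sign i = 1 :> R.
Proof. by rewrite /half_sign; case: ifP; rewrite ?mulr1 // mulrNN mulr1. Qed.

Lemma sum_half_sign : ~~ odd n -> \sum_(i < n) half_sign i = 0 :> R.
Proof.
move=> nodd; have nE : n = (n./2 + n./2)%N by rewrite addnn even_halfK.
rewrite /half_sign; move: n./2 nE => h ->.
rewrite big_split_ord /= (eq_bigr (fun=> 1)); last by move=> i _; rewrite ltn_ord.
rewrite [X in _ + X](eq_bigr (fun=> -1)); last first.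
  by move=> i _; rewrite ltnNge leq_addr.
by rewrite !sumr_const card_ord mulNrn subrr.
Qed.

Lemma half_mx_sym (V : 'M[R]_n) i j : half_mx V i j = half_mx V j i.
Proof. by rewrite /half_mx !spec_mxE; apply: eq_bigr => k _; rewrite (mulrC (V i k)). Qed.

Lemma half_mx_trace (V : 'M[R]_n) : ~~ odd n -> V^T *m V = 1%:M ->
  \sum_i half_mx V i i = 0.
Proof.
move=> nodd VV; rewrite -[RHS](sum_half_sign nodd).
under eq_bigr do rewrite /half_mx spec_mxE.
rewrite exchange_big; apply: eq_bigr => k _ /=; rewrite -mulr_sumr.
have := congr1 (fun B : 'M[R]_n => B k k) VV; rewrite !mxE eqxx mulr1n => e.
rewrite -[RHS]mulr1 -[in RHS]e; congr (_ * _).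
by apply: eq_bigr => i _; rewrite !mxE.
Qed.

Lemma half_mx_row (V : 'M[R]_n) i : V^T *m V = 1%:M ->
  \sum_j half_mx V i j ^+ 2 = 1.
Proof.
move=> VV; have MM : half_mx V *m half_mx V = 1%:M.
  have DD : diag_mx (\row_i (half_sign i : R)) *m diag_mx (\row_(i < n) half_sign i) = 1%:M.
    apply/matrixP => k l; rewrite mul_diag_mx !mxE.
    by case: eqP => _; rewrite ?mulr0n ?mulr0 // !mulr1n half_sign_sqr.
  rewrite /half_mx /spec_mx !mulmxA -(mulmxA _ V^T V) VV mulmx1.
  by rewrite -(mulmxA V) DD mulmx1 (orthogonal_tr VV).
have := congr1 (fun B : 'M[R]_n => B i i) MM; rewrite [LHS]mxE [RHS]mxE eqxx mulr1n => <-.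
by apply: eq_bigr => j _; rewrite expr2 [in X in _ * X]half_mx_sym.
Qed.
End half_mx_facts.

Section sign_vectors.
Context {R : realType}.

Lemma sum_square_split (F : nat -> nat -> R) m :
  \sum_(i < m) \sum_(j < m) F i j =
  \sum_(i < m) F i i + \sum_(j < m) \sum_(i < j) (F i j + F j i).
Proof.
elim: m => [|m IH]; first by rewrite !big_ord0 addr0.
have E : \sum_(i < m) \sum_(j < m.+1) F i j =
    \sum_(i < m) \sum_(j < m) F i j + \sum_(i < m) F i m.
  by rewrite -big_split; apply: eq_bigr => i _; rewrite big_ord_recr.
rewrite [LHS]big_ord_recr /= E IH [X in _ + X = _]big_ord_recr /=.
rewrite [X in _ = X + _]big_ord_recr [X in _ = _ + X]big_ord_recr /= big_split /=.
by ring.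
Qed.

(** Sign sequences are indexed by [nat] because the moment bounds go by induction on their length;
    the matrix is extended by 0 to match. *)
Definition ext_mx {n : nat} (M : 'M[R]_n) (i j : nat) : R :=
  match insub i, insub j with Some a, Some b => M a b | _, _ => 0 end.

Lemma ext_mxE (n : nat) (M : 'M[R]_n) (i j : 'I_n) : ext_mx M i j = M i j.
Proof. by rewrite /ext_mx !valK. Qed.

Lemma ext_mx_sym (n : nat) (M : 'M[R]_n) i j : (forall a b, M a b = M b a) ->
  ext_mx M i j = ext_mx M j i.
Proof. by move=> sM; rewrite /ext_mx; case: insub => [a|]; case: insub. Qed.

Definition sign_vec (n : nat) (e : nat -> R) : 'cV[R]_n :=
  \col_i (e i / Num.sqrt n%:R).

Lemma sign_vec_unit (n : nat) (e : nat -> R) : (0 < n)%N -> e \in signs n ->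
  ((sign_vec n e)^T *m sign_vec n e) 0 0 = 1.
Proof.
move=> n0 es; rewrite mxE (eq_bigr (fun=> n%:R^-1)).
  by rewrite sumr_const card_ord -[LHS]mulr_natr mulVf // pnatr_eq0 -lt0n.
move=> i _; rewrite !mxE -expr2 expr_div_n (signs_sqr es) //.
by rewrite sqr_sqrtr ?ler0n // div1r.
Qed.

Definition chaos {n : nat} (M : 'M[R]_n) (e : nat -> R) : R :=
  \sum_(j < n) e j * \sum_(i < j) (2 * ext_mx M i j) * e i.

(** The squares of the signs being 1, the diagonal contributes the trace, which is 0; a homogeneous
    chaos of order 2 remains. This is where the balance of the two halves of the spectrum is
    used. *)
Lemma quad_sign_vec (n : nat) (M : 'M[R]_n) (e : nat -> R) : (0 < n)%N ->
  (forall a b, M a b = M b a) -> \sum_i M i i = 0 -> e \in signs n ->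
  quad (sign_vec n e) M = n%:R^-1 * chaos M e.
Proof.
move=> n0 sM tM es; rewrite quadE.
pose F i j := e i * e j * ext_mx M i j.
transitivity (n%:R^-1 * \sum_(i < n) \sum_(j < n) F i j).
  rewrite mulr_sumr; apply: eq_bigr => i _; rewrite mulr_sumr; apply: eq_bigr => j _.
  rewrite !mxE /F ext_mxE mulrACA -invfM -expr2 sqr_sqrtr ?ler0n //; ring.
congr (_ * _); rewrite sum_square_split.
rewrite (eq_bigr (fun i => M i i)) ?tM ?add0r; last first.
  by move=> i _; rewrite /F ext_mxE -expr2 (signs_sqr es) // mul1r.
apply: eq_bigr => j _; rewrite mulr_sumr; apply: eq_bigr => i _.
by rewrite /F (ext_mx_sym j i sM); ring.
Qed.

Lemma chaos_weight (n : nat) (M : 'M[R]_n) : (forall a b, M a b = M b a) ->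
  (forall i, \sum_j M i j ^+ 2 = 1) ->
  \sum_(j < n) \sum_(i < j) (2 * ext_mx M i j) ^+ 2 <= 2 * n%:R.
Proof.
move=> sM rM.
have : \sum_(i < n) \sum_(j < n) ext_mx M i j ^+ 2 = n%:R.
  rewrite (eq_bigr (fun=> 1)) ?sumr_const ?card_ord // => i _.
  by rewrite -[RHS](rM i); apply: eq_bigr => j _; rewrite ext_mxE.
rewrite (sum_square_split (fun i j => ext_mx M i j ^+ 2)) => <-.
rewrite mulrDr [X in X <= _](_ : _ = 2 * \sum_(j < n) \sum_(i < j)
   (ext_mx M i j ^+ 2 + ext_mx M j i ^+ 2)); last first.
  rewrite mulr_sumr; apply: eq_bigr => j _; rewrite mulr_sumr; apply: eq_bigr => i _.
  by rewrite (ext_mx_sym j i sM); ring.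
by rewrite lerDr mulr_ge0 // sumr_ge0 // => i _; exact: sqr_ge0.
Qed.

(** Markov's inequality for the 2p-th moment over uniform signs, at a fixed matrix. Although each
    sign vector may bring its own decomposition, [half_mx_unique] makes the quadratic form common to
    all. *)
Lemma tail_count (n p : nat) (al t : R) (A : 'M[R]_n) (k : 'I_n) :
  ~~ odd n -> (0 < p)%N -> 0 <= t -> \det (krylov A) != 0 ->
  t ^+ (2 * p) *
    \sum_(e <- signs n) (`[< tail_event al 0 t (sign_vec n e) k A >])%:R <=
  (al ^+ 2 * (2 * (4 * p + 1)%:R ^+ 2) / n%:R) ^+ p * (2 ^ n)%:R.
Proof.
move=> nodd p0 t0 dA.
have n0 : (0 < n)%N by apply: leq_trans (ltn_ord k).
have nR : 0 < n%:R :> R by rewrite ltr0n.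
have b0 : 0 <= al ^+ 2 * (2 * (4 * p + 1)%:R ^+ 2) / n%:R.
  apply: divr_ge0 => //; apply: mulr_ge0; first exact: sqr_ge0.
  by apply: mulr_ge0 => //; exact: sqr_ge0.
(* If there were no decomposition, every event would be false and the sum 0; the spectral theorem is
   thus not invoked. *)
have [[lam [V sd]]|no] := pselect (exists lam V, spectral_decomp A lam V); last first.
  rewrite big1 ?mulr0; last first.
    move=> e _; case: asboolP => // -[lam [V [sd _]]].
    by exfalso; apply: no; exists lam, V.
  by rewrite mulr_ge0 // exprn_ge0.
have /spectral_decompP[VV _ _] := sd.
set M := half_mx V.
have sM a b : M a b = M b a by exact: half_mx_sym.
have key e : e \in signs n ->
    t ^+ (2 * p) * (`[< tail_event al 0 t (sign_vec n e) k A >])%:R <=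
    (al / n%:R) ^+ (2 * p) * chaos M e ^+ (2 * p).
  move=> es; have even_ge0 (y : R) : 0 <= y ^+ (2 * p) by rewrite exprM exprn_ge0 ?sqr_ge0.
  case: asboolP => [|_]; last by rewrite mulr0 mulr_ge0.
  move=> [lam' [V' [sd' h]]]; rewrite mulr1.
  move: h; rewrite -(half_mx_unique dA sd sd') mul0r subr0 -/M.
  rewrite quad_sign_vec //; last exact: half_mx_trace.
  move=> h; rewrite -exprMn -mulrA.
  rewrite [leRHS]exprM -real_normK ?num_real // -exprM lerXn2r ?nnegrE //.
rewrite mulr_sumr; apply: (@le_trans _ _ (\sum_(e <- signs n)
    (al / n%:R) ^+ (2 * p) * chaos M e ^+ (2 * p))).
  by rewrite !big_seq; apply: ler_sum.
rewrite -mulr_sumr (exprM (al / n%:R)).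
have sq := sum_signs_quadratic p0 (fun i j => 2 * ext_mx M i j) n.
apply: le_trans (ler_wpM2l _ sq) _; first by rewrite exprn_ge0 ?sqr_ge0.
rewrite [leLHS]mulrA -(exprMn p ((al / n%:R) ^+ 2)); apply: ler_wpM2r => //.
apply: lerXn2r; rewrite ?nnegrE.
- apply: mulr_ge0; first exact: sqr_ge0.
  apply: mulr_ge0; first exact: sqr_ge0.
  by apply: sumr_ge0 => j _; apply: sumr_ge0 => i _; exact: sqr_ge0.
- exact: b0.
have w := chaos_weight sM (fun i => half_mx_row i VV).
set c : R := (4 * p + 1)%:R.
apply: (@le_trans _ _ ((al / n%:R) ^+ 2 * (c ^+ 2 * (2 * n%:R)))).
  by rewrite ler_wpM2l ?sqr_ge0 // ler_wpM2l ?sqr_ge0.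
rewrite le_eqVlt; apply/orP; left; apply/eqP; field; by rewrite gt_eqF.
Qed.

(** By invariance the 2^n sign vectors give events of equal probability, so 2^n times it is the
    expected number of sign vectors whose event occurs; off the null set [N], [tail_count] bounds
    that number pointwise. *)
Lemma tail_prob (n p : nat) (al t : R) (k : 'I_n) (d : measure_display)
    (T : measurableType d) (P : probability T R) (G : 'I_n -> 'I_n -> T -> R) :
  is_GOE P G -> ~~ odd n -> (0 < p)%N -> 0 < t ->
  (P [set w | (tail_event al 0 t (delta_mx k 0) k (GOE_mx G w))%R] <=
  ((al ^+ 2 * (2 * (4 * p + 1)%:R ^+ 2) / n%:R) ^+ p / t ^+ (2 * p))%:E)%E.
Proof.
move=> GG nodd p0 t0.
have n0 : (0 < n)%N by apply: leq_trans (ltn_ord k).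
have b0 : 0 <= al ^+ 2 * (2 * (4 * p + 1)%:R ^+ 2) / n%:R.
  apply: divr_ge0 => //; apply: mulr_ge0; first exact: sqr_ge0.
  by apply: mulr_ge0 => //; exact: sqr_ge0.
set E := [set w | _]; set b := (X in (_ <= (X / _)%:E)%E).
have {}b0 : 0 <= b by exact: exprn_ge0.
have tp : 0 < t ^+ (2 * p) by rewrite exprn_gt0.
pose N := [set w | \det (krylov (GOE_mx G w)) = 0].
have mN : measurable N by exact: (measurable_goe GG (@event_krylov n R)).
have PN : P N = 0%E by exact: (goe_krylov0 GG).
pose Ee e := [set w | tail_event al 0 t (sign_vec n e) k (GOE_mx G w)] `\` N.
have mE u : measurable [set w | tail_event al 0 t u k (GOE_mx G w)].
  exact: (measurable_goe GG (event_tail al 0 t u k)).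
have mEe e : measurable (Ee e) by exact: measurableD.
have PEe e : e \in signs n -> P (Ee e) = P E.
  move=> es; pose Se := [set w | tail_event al 0 t (sign_vec n e) k (GOE_mx G w)].
  have PSN : P (Se `&` N) = 0%E.
    by apply: (subset_measure0 _ _ _ PN) => //; apply: measurableI => //; exact: mE.
  have -> : P (Ee e) = (P Se - P (Se `&` N))%E.
    by apply: measureD => //; rewrite ltey_eq fin_num_measure //; exact: mE.
  rewrite PSN sube0; exact: (tail_unit GG al t k (sign_vec_unit n0 es)).
have [r PE] : exists r : R, P E = r%:E.
  by exists (fine (P E)); rewrite fineK // fin_num_measure //; exact: mE.
have main : (\sum_(e <- signs n) P (Ee e) <= (b / t ^+ (2 * p) * (2 ^ n)%:R)%:E)%E.
  have -> : (\sum_(e <- signs n) P (Ee e) =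
      \int[P]_w (\sum_(e <- signs n) (\1_(Ee e) w)%:E))%E.
    rewrite ge0_integral_sum //.
    - by apply: eq_bigr => e _; rewrite integral_indic // setIT.
    - by move=> e; apply/measurable_EFinP; exact: measurable_indic.
  have -> : (b / t ^+ (2 * p) * (2 ^ n)%:R)%:E =
      (\int[P]_w (cst (b / t ^+ (2 * p) * (2 ^ n)%:R)%:E) w)%E.
    rewrite integral_cst // [X in (_ * X)%E](_ : _ = 1%E) ?mule1 //.
    exact: probability_setT.
  apply: ge0_le_integral => //.
  - by move=> w _; apply: sume_ge0.
  - by apply: emeasurable_sum => e; apply/measurable_EFinP; exact: measurable_indic.
  move=> w _; rewrite sumEFin lee_fin.
  have [Nw|nNw] := pselect (N w).
    rewrite big1; last first.
      by move=> e _; rewrite indicE memNset // => -[].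
    by apply: mulr_ge0 => //; apply: divr_ge0 => //; exact: ltW.
  have dA : \det (krylov (GOE_mx G w)) != 0 by apply/eqP.
  have h := tail_count al k nodd p0 (ltW t0) dA.
  rewrite [leRHS]mulrAC ler_pdivlMr // [leLHS]mulrC; apply: le_trans h.
  apply: ler_wpM2l; first exact: ltW.
  apply: ler_sum => e _.
  rewrite indicE; case: asboolP => h; first by case: (_ \in _).
  by rewrite memNset // => -[].
move: main; rewrite big_seq (eq_bigr (fun=> r%:E)); last by move=> e es; rewrite PEe.
rewrite -big_seq sumEFin lee_fin big_const_seq count_predT iter_addr addr0 size_signs.
rewrite -[leLHS]mulr_natr ler_pM2r ?ltr0n ?expn_gt0 // => rb.
by rewrite PE lee_fin.
Qed.
End sign_vectors.

Lemma expRN_le_poly {R : realType} (y : R) (p : nat) : 0 < y ->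
  expR (- y) <= p.+1`!%:R / y ^+ p.+1.
Proof.
move=> y0; have h := expR_ge1Dxn p (ltW y0).
have f0 : 0 < (p.+1)`!%:R :> R by rewrite ltr0n fact_gt0.
have yp : 0 < y ^+ p.+1 by rewrite exprn_gt0.
rewrite expRN -[leRHS]invrK lef_pV2 ?posrE ?expR_gt0 ?invr_gt0 ?divr_gt0 //.
by rewrite invf_div; apply: le_trans h; rewrite lerDr.
Qed.

(** * Combination of the chaos bound with the Gaussian tail of the diagonal entry *)

Section assembly.
Context {R : realType} {n : nat} {d : measure_display} {T : measurableType d}.
Variables (P : probability T R) (G : 'I_n -> 'I_n -> T -> R).
Hypothesis GG : is_GOE P G.

Lemma goe_diag_tail (C0 : R) (k : 'I_n) (t : R) :
  (forall s, 0 <= s -> (normal_prob 0 (Num.sqrt 2) [set x : R | (s <= `|x|)%R] <=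
     (C0 * expR (- (s ^+ 2 / (Num.sqrt 2 ^+ 2 *+ 4))))%:E)%E) -> 0 <= t ->
  (P [set w | (t <= `|GOE_mx G w k k|)%R] <= (C0 * expR (- (t ^+ 2 / 8)))%:E)%E.
Proof.
move=> hC0 t0; have [mG _ normG _] := GG.
have mA : measurable [set x : R | (t <= `|x|)%R].
  rewrite -[X in measurable X]setTI.
  by apply: measurable_fun_le => //=; exact: measurableT_comp.
have -> : [set w | (t <= `|GOE_mx G w k k|)%R] = G k k @^-1` [set x : R | (t <= `|x|)%R].
  by apply/seteqP; split => w /=; rewrite mxE.
rewrite (normG _ _ _ (leqnn k) mA) /goe_sd eqxx.
apply: le_trans (hC0 t t0) _; rewrite sqr_sqrtr //.
by rewrite -mulrnA.
Qed.

Lemma Zmat_event (k : 'I_n) (x : R) :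
  [set w | exists (lam : 'I_n -> R) (V : 'M[R]_n),
     spectral_decomp (GOE_mx G w) lam V /\ (x <= `|Zmat lam V k k|)%R] =
  [set w | tail_event ((3 * pi / 8) * Num.sqrt n%:R) 1 x (delta_mx k 0) k (GOE_mx G w)].
Proof.
have qE (M : 'M[R]_n) : quad (delta_mx k 0) M = M k k.
  rewrite /quad mxE (bigD1 k) //= big1 ?addr0; last first.
    by move=> i ik; rewrite [delta_mx _ _ _ _]mxE (negbTE ik) mulr0.
  rewrite [delta_mx _ _ _ _]mxE !eqxx mulr1 mxE (bigD1 k) //= big1 ?addr0; last first.
    by move=> i ik; rewrite !mxE (negbTE ik) mul0r.
  by rewrite !mxE !eqxx mul1r.
have ZE (A : 'M[R]_n) lam V : spectral_decomp A lam V ->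
    Zmat lam V k k = (3 * pi / 8) * Num.sqrt n%:R * quad (delta_mx k 0) (half_mx V) - 1 * A k k.
  by move=> sd; rewrite (ZmatE sd) qE mul1r [LHS]mxE [X in X + _]mxE [X in _ + X]mxE.
apply/seteqP; split => w [lam [V [sd h]]]; exists lam, V; split=> //;
  by move: h; rewrite (ZE _ _ _ sd).
Qed.

Lemma tail_event_split (al x : R) (u : 'cV[R]_n) (k : 'I_n) (A : 'M[R]_n) :
  tail_event al 1 x u k A ->
  tail_event al 0 (x / 2) u k A \/ x / 2 <= `|A k k|.
Proof.
move=> [lam [V [sd h]]]; have [le|gt] := leP (x / 2) `|A k k|; first by right.
left; exists lam, V; split=> //; rewrite mul0r subr0; move: h; rewrite mul1r => h.
have := le_trans h (ler_normB _ _); lra.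
Qed.

(** [C0] is a parameter so that the final constant can be chosen before [n] and the probability
    space. The Gaussian tail is weakened to the power of [x] that the chaos bound provides. *)
Lemma Zmat_tail (C0 : R) (k : 'I_n) (x : R) (p : nat) : 0 <= C0 ->
  (forall s, 0 <= s -> (normal_prob 0 (Num.sqrt 2) [set x : R | (s <= `|x|)%R] <=
     (C0 * expR (- (s ^+ 2 / (Num.sqrt 2 ^+ 2 *+ 4))))%:E)%E) ->
  ~~ odd n -> 0 < x ->
  (P [set w | exists (lam : 'I_n -> R) (V : 'M[R]_n),
     spectral_decomp (GOE_mx G w) lam V /\ (x <= `|Zmat lam V k k|)%R] <=
   (((18 * (4 * p.+1 + 1)%:R ^+ 2) ^+ p.+1 + C0 * (p.+1`!%:R * 32 ^+ p.+1)) /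
    x ^+ (2 * p.+1))%:E)%E.
Proof.
move=> C00 hC0 nodd x0; rewrite Zmat_event.
have n0 : 0 < n%:R :> R by rewrite ltr0n; apply: leq_trans (ltn_ord k).
set al := (3 * pi / 8) * Num.sqrt n%:R.
have x2 : 0 < x / 2 by rewrite divr_gt0.
have xp : 0 < x ^+ (2 * p.+1) by rewrite exprn_gt0.
set E1 := [set w | tail_event al 0 (x / 2) (delta_mx k 0) k (GOE_mx G w)].
pose E2 := [set w | (x / 2 <= `|GOE_mx G w k k|)%R].
have mE u be t : measurable [set w | tail_event al be t u k (GOE_mx G w)].
  exact: (measurable_goe GG (event_tail al be t u k)).
have mE2 : measurable E2.
  rewrite -[X in measurable X]setTI; apply: measurable_fun_le => //=.
  apply: measurableT_comp => //; under eq_fun do rewrite mxE.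
  by have [mG _ _ _] := GG; exact: mG.
have PE1 := tail_prob al k GG nodd (ltn0Sn p) x2; rewrite -/E1 in PE1.
have PE2 := goe_diag_tail k hC0 (ltW x2); rewrite -/E2 in PE2.
apply: (@le_trans _ _ (P (E1 `|` E2))).
  apply: le_measure; rewrite ?inE; [exact: mE|by apply: measurableU => //; exact: mE|].
  by move=> w /tail_event_split[]; [left|right].
apply: le_trans (measureU2 P (mE _ _ _) mE2) _.
apply: le_trans (leeD PE1 PE2) _; rewrite -EFinD lee_fin [leRHS]mulrDl; apply: lerD.
  set c2 : R := (4 * p.+1 + 1)%:R ^+ 2.
  have c20 : 0 <= c2 by exact: sqr_ge0.
  (* From pi <= 4, (3 pi / 8)^2 <= 9/4; doubling gives 18/4, and the 4 lost by halving the threshold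
     gives 18. Likewise 32 below is 8 times 4. *)
  have al2 : al ^+ 2 * (2 * c2) / n%:R <= 18 / 4 * c2.
    rewrite /al exprMn sqr_sqrtr ?ler0n //.
    have -> : (3 * pi / 8) ^+ 2 * n%:R * (2 * c2) / n%:R = (3 * (pi / 8)) ^+ 2 * (2 * c2).
      by field; rewrite gt_eqF.
    have pi4 : pi <= 4 :> R by have := @pihalf_lt2 R; lra.
    have pi0 := @pi_ge0 R.
    have pp : pi * pi <= 16 :> R by nra.
    have : (3 * (pi / 8)) ^+ 2 <= 18 / 8 :> R by nra.
    by move=> h; have := ler_wpM2r c20 h; lra.
  have e0 : 0 <= al ^+ 2 * (2 * c2) / n%:R.
    apply: divr_ge0; last exact: ltW.
    by apply: mulr_ge0; [exact: sqr_ge0|exact: mulr_ge0].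
  have -> : (x / 2) ^+ (2 * p.+1) = x ^+ (2 * p.+1) / 4 ^+ p.+1.
    by rewrite expr_div_n [2 ^+ _]exprM; congr (_ / _ ^+ _); ring.
  rewrite invf_div [leLHS]mulrA -[X in X / _ <= _]exprMn.
  apply: ler_wpM2r; first by rewrite invr_ge0 ltW.
  apply: lerXn2r; rewrite ?nnegrE; [by rewrite mulr_ge0|by rewrite mulr_ge0|].
  by rewrite -/c2; lra.
rewrite -mulrA ler_wpM2l //.
have y0 : 0 < (x / 2) ^+ 2 / 8 by rewrite divr_gt0 // exprn_gt0.
apply: le_trans (expRN_le_poly p y0) _.
have -> : (x / 2) ^+ 2 / 8 = x ^+ 2 / 32 by field.
rewrite expr_div_n -exprM invf_div.
by rewrite mulrA.
Qed.
End assembly.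

Theorem theoremC5 (R : realType) (K : R) (hK : 0 < K) :
  exists (C : R) (N : nat),
    forall n : nat, ~~ odd n -> (N <= n)%N ->
    forall (d : measure_display) (T : measurableType d) (P : probability T R)
           (G : 'I_n -> 'I_n -> T -> R),
    is_GOE P G ->
    forall k : 'I_n,
      (P [set w | exists (lam : 'I_n -> R) (V : 'M[R]_n),
                    spectral_decomp (GOE_mx G w) lam V /\
                    (n%:R `^ (6^-1) <= `|Zmat lam V k k|)%R ]
       <= (C * n%:R `^ (- K))%:E)%E.
Proof.
have s2 : Num.sqrt 2 != 0 :> R by rewrite sqrtr_eq0 -ltNge ltr0n.
have [C0 C00 hC0] := normal_prob_tail s2.
(* At x = n^(1/6) the denominator x^(2(p+1)) is n^((p+1)/3), so p + 1 >= 3K is what is required. *)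
pose p := Num.bound (3 * K).
have Kp : 3 * K <= p.+1%:R.
  have K0 : 0 <= 3 * K by rewrite mulr_ge0 // ltW.
  by apply: ltW; apply: lt_trans (archi_boundP K0) _; rewrite ltr_nat.
exists ((18 * (4 * p.+1 + 1)%:R ^+ 2) ^+ p.+1 + C0 * (p.+1`!%:R * 32 ^+ p.+1)), 1%N.
move=> n nodd n1 d T P G GG k.
have nR : 0 < n%:R :> R by rewrite ltr0n.
have x0 : 0 < n%:R `^ (6^-1) :> R by rewrite powR_gt0.
apply: le_trans (Zmat_tail GG k p C00 hC0 nodd x0) _.
rewrite lee_fin; apply: ler_wpM2l.
  apply: addr_ge0.
    by apply: exprn_ge0; apply: mulr_ge0 => //; exact: sqr_ge0.
  by apply: mulr_ge0 => //; apply: mulr_ge0 => //; exact: exprn_ge0.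
rewrite -powR_invn ?powR_ge0 // -powRrM; apply: ler_powR; first by rewrite ler1n.
by rewrite natrM; lra.
Qed.
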